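(* Let $n\ge1$ and let $a_{1,1},\dots,a_{1,n}\in\mathcal G(\mathbb R^{n+1})$ be Colombeau generalised functions of $(t,x)\in\mathbb R\times\mathbb R^n$. (1) Assume that the $a_{1,j}$ are real valued, compactly supported with respect to $x$, and that $\partial_{x_k}a_{1,j}$ is of logarithmic type for all $k,j=1,\dots,n$. Let $\omega_h\in\mathcal G(\mathbb R^{n+1})$ be the unique real valued solution of $\partial_t\omega_h=\sum_{j=1}^na_{1,j}\partial_{x_j}\omega_h$, $\omega_h(0,x)=x_h$, $h=1,\dots,n$, and let $\gamma=(\gamma_1,\dots,\gamma_n)$ be the characteristic curve. Then the generalised phase function $$\phi(t,x,\eta)=\sum_{h=1}^n\omega_h(t,x)\eta_h=\sum_{h=1}^n\gamma_h(x,t,0)\eta_h$$ solves the eikonal Cauchy problem $$\partial_t\phi(t,x,\eta)=\sum_{j=1}^na_{1,j}(t,x)\,\partial_{x_j}\phi(t,x,\eta),\qquad \phi(0,x,\eta)=x\eta .$$ (2) Assume that the $a_{1,j}$ are real valued, slow scale regular, compactly supported with respect to $x$, and that $\partial_{x_k}a_{1,j}$ is of slow scale logarithmic type for all $k,j=1,\dots,n$. Then $\phi$ is a slow scale generalised phase function.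
   Context: Nets are indexed by $\varepsilon\in(0,1]$ and $O(\cdot)$ refers to $\varepsilon\to0$. $\mathcal G(\mathbb R^d)=\mathcal E_M(\mathbb R^d)/\mathcal N(\mathbb R^d)$ is the Colombeau algebra: $\mathcal E_M$ consists of nets $(u_\varepsilon)_\varepsilon$ in $C^\infty(\mathbb R^d)$ such that for all compact $K$ and all $\alpha$ there is $N\in\mathbb N$ with $\sup_K|\partial^\alpha u_\varepsilon|=O(\varepsilon^{-N})$; $\mathcal N$ consists of those nets with $\sup_K|\partial^\alpha u_\varepsilon|=O(\varepsilon^q)$ for all compact $K$, all $\alpha$, all $q\in\mathbb N$. Operations are performed on representatives, and equations are equalities of generalised functions. A slow scale net is a net $(\mu_\varepsilon)_\varepsilon$ in $\mathbb C$ with $|\mu_\varepsilon|^q=O(\varepsilon^{-1})$ for all $q\ge0$. An element $u\in\mathcal G(\mathbb R^d)$ is: real valued if it has a representative of real valued functions; of logarithmic type if it has a representative with $\sup_K|u_\varepsilon|=O(\log(\varepsilon^{-1}))$ for all compact $K$; of slow scale logarithmic type if it has a representative such that for every compact $K$ there is a slow scale net $(\mu_\varepsilon)$ with $\sup_K|u_\varepsilon|=O(\log\mu_\varepsilon)$; slow scale regular if it has a representative such that for every compact $K$ and every $\alpha$ there is a slow scale net $(\mu_\varepsilon)$ with $\sup_K|\partial^\alpha u_\varepsilon|=O(\mu_\varepsilon)$. A generalised function of $(t,x)$ is compactly supported in $x$ if its support is contained in $\mathbb R\times K$ for some compact $K\subset\mathbb R^n$. The characteristic curve $\gamma_h=\gamma_h(x,t,s)\in\mathcal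 G(\mathbb R^{n+2})$ is the unique solution of $\frac{d}{ds}\gamma_h(x,t,s)=-a_{1,h}(s,\gamma_1(x,t,s),\dots,\gamma_n(x,t,s))$, $\gamma_h(x,t,t)=x_h$, $h=1,\dots,n$ (known to be well-posed under the hypotheses of (1)). Phase functions. $S^1_{\rm hg}(\Omega\times\mathbb R^p\setminus0)$ is the space of smooth symbols homogeneous of degree 1 in $\xi$, with seminorms $\sup_{x\in K,\xi\ne0}|\xi|^{-1+|\alpha|}|\partial_\xi^\alpha\partial_x^\beta a(x,\xi)|$, $K\subset\Omega$ compact. By a convention of the paper, calling $\phi(t,x,\eta)$ a generalised phase function means that $\phi$ is given by a net $(\phi_\varepsilon)$ of real valued symbols in $S^1_{\rm hg}(\mathbb R^{n+1}\times\mathbb R^n\setminus0)$, each seminorm of which is $O(\varepsilon^{-N})$ for some $N$ (modulo nets all of whose seminorms are $O(\varepsilon^q)$ for all $q$), and that $\phi'(t,x,y,\eta)=\phi(t,x,\eta)-y\eta$ is a generalised phase function with respect to $(y,\eta)$: $\nabla_{y,\eta}\phi'_\varepsilon\neq0$ for $\eta\ne0$ and, for all compact sets $K'\subset\mathbb R^{n+1}$, $K\subset\mathbb R^n$, the net $\inf_{(t,x)\in K',y\in K,\eta\ne0}|\nabla_{y,\eta}\phi'_\varepsilon(t,x,y,\eta/|\eta|)|^2$ is bounded below by $\varepsilon^r$ for some $r>0$ and all small $\varepsilon$. It is a slow scale generalised phase function if there is a representative such that every seminorm is $O(\mu_\varepsilon)$ for some slow scale net $(\mu_\varepsilon)$ and,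 for all compact sets $K'\subset\mathbb R^{n+1}$, $K\subset\mathbb R^n$, the infimum $\inf_{(t,x)\in K',y\in K,\eta\ne0}|\nabla_{y,\eta}\phi'_\varepsilon(t,x,y,\eta/|\eta|)|^2$ is bounded below by $1/s_\varepsilon$ for all small $\varepsilon$, for some slow scale net $(s_\varepsilon)$. *)

(* Defs.v *)
From HB Require Import structures.
From mathcomp Require Import all_boot all_order all_algebra.
From mathcomp Require Import complex.
From mathcomp Require Import all_classical all_reals all_analysis.
Set Implicit Arguments.
Unset Strict Implicit.
Unset Printing Implicit Defensive.
Import Order.TTheory GRing.Theory Num.Theory.
Import numFieldNormedType.Exports.
Local Open Scope classical_set_scope.
Local Open Scope ring_scope.
Local Open Scope complex_scope.

(* Nets are functions of eps : R that are only looked at for 0 < eps <= 1.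
   Generalised functions are handled through their representatives: an element
   of G(R^d) is given by a net u with [moderate u], two nets give the same
   element iff [u =G v], and every predicate on elements of G(R^d) below that
   reads "has a representative such that" quantifies over the whole class. *)

Section Calculus.
Variable R : realType.

Definition cabs (z : R[i]) : R := ComplexField.Normc.normc z.

Definition enorm d (x : 'rV[R]_d) : R := Num.sqrt (\sum_i x 0 i ^+ 2).

Definition dotp d (x y : 'rV[R]_d) : R := \sum_i x 0 i * y 0 i.

(* R[i] carries no structure of normed space over R, so that complex valued
   functions are differentiated componentwise. *)
Definition pd1 d (i : 'I_d) (f : 'rV[R]_d -> R[i]) : 'rV[R]_d -> R[i] :=
  fun x => 'D_(delta_mx 0 i) (fun y => complex.Re (f y)) x
        +i* 'D_(delta_mx 0 i) (fun y => complex.Im (f y)) x.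

(* A derivative of order k is indexed by the sequence of the k coordinates of
   differentiation; multi-indices are the sorted sequences, and the order of
   the sequence is irrelevant on smooth functions. *)
Definition pd d (s : seq 'I_d) (f : 'rV[R]_d -> R[i]) : 'rV[R]_d -> R[i] :=
  foldr (@pd1 d) f s.

(* C^oo on an open set D *)
Definition smooth_on d (D : set 'rV[R]_d) (f : 'rV[R]_d -> R[i]) : Prop :=
  forall (s : seq 'I_d) (x : 'rV[R]_d), D x ->
    differentiable (fun y => complex.Re (pd s f y)) x /\
    differentiable (fun y => complex.Im (pd s f y)) x.

Definition grad d (f : 'rV[R]_d -> R[i]) (x : 'rV[R]_d) : 'rV[R[i]]_d :=
  \row_i pd1 i f x.

(* f_eps = O(g_eps); no absolute value is put on g, so that the bound fails
   where g is negative (this matters for O(log mu_eps)). *)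
Definition bigOeps (f : R -> \bar R) (g : R -> R) : Prop :=
  exists2 C : R, 0 < C & \forall e \near 0^'+, (f e <= (C * g e)%:E)%E.

Definition slow_scale (mu : R -> R[i]) : Prop :=
  forall q : R, 0 <= q ->
    bigOeps (fun e => (cabs (mu e) `^ q)%:E) (fun e => e^-1).

End Calculus.

Section Colombeau.
Variable R : realType.

Definition net d := R -> 'rV[R]_d -> R[i].

Definition supK d (K : set 'rV[R]_d) (f : 'rV[R]_d -> R[i]) : \bar R :=
  ereal_sup [set (cabs (f x))%:E | x in K].

Definition smooth_net d (u : net d) : Prop :=
  forall e : R, 0 < e <= 1 -> smooth_on setT (u e).

Definition moderate d (u : net d) : Prop :=
  smooth_net u /\
  forall K, compact K -> forall s : seq 'I_d, exists N : nat,
    bigOeps (fun e => supK K (pd s (u e))) (fun e => e ^- N).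

(* the restriction of u to the open set U is 0 in G(U) *)
Definition vanishes_on d (U : set 'rV[R]_d) (u : net d) : Prop :=
  forall K, compact K -> K `<=` U -> forall (s : seq 'I_d) (q : nat),
    bigOeps (fun e => supK K (pd s (u e))) (fun e => e ^+ q).

Definition negligible_net d (u : net d) : Prop :=
  smooth_net u /\ vanishes_on setT u.

Definition geq d (u v : net d) : Prop :=
  negligible_net (fun e x => u e x - v e x).

Definition is_repr d (u v : net d) : Prop := moderate v /\ geq u v.

Definition real_net d (u : net d) : Prop :=
  forall (e : R) (x : 'rV[R]_d), 0 < e <= 1 -> complex.Im (u e x) = 0.

Definition real_valued d (u : net d) : Prop :=
  exists2 v, is_repr u v & real_net v.

Definition log_type d (u : net d) : Prop :=
  exists2 v, is_repr u v &
    forall K, compact K ->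
      bigOeps (fun e => supK K (v e)) (fun e => ln e^-1).

(* log mu_eps is read as log |mu_eps|, mu being complex valued *)
Definition slow_log_type d (u : net d) : Prop :=
  exists2 v, is_repr u v &
    forall K, compact K -> exists2 mu, slow_scale mu &
      bigOeps (fun e => supK K (v e)) (fun e => ln (cabs (mu e))).

Definition slow_regular d (u : net d) : Prop :=
  exists2 v, is_repr u v &
    forall K, compact K -> forall s : seq 'I_d, exists2 mu, slow_scale mu &
      bigOeps (fun e => supK K (pd s (v e))) (fun e => cabs (mu e)).

Definition gsupp d (u : net d) : set 'rV[R]_d :=
  [set z | forall U, open U -> U z -> ~ vanishes_on U u].

End Colombeau.

Notation "u =G v" := (geq u v) (at level 70, no associativity).

(* Points of R^{n+1} are (t, x) = row_mx t x : 'rV_(1 + n), and points of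
   R^{n+2} are (x, t, s) = row_mx x (row_mx t s) : 'rV_(n + (1 + 1)). *)
Section Transport.
Variables (R : realType) (n : nat).

Definition i_t : 'I_(1 + n) := lshift n 0.
Definition i_x (k : 'I_n) : 'I_(1 + n) := rshift 1 k.
Definition i_s : 'I_(n + (1 + 1)) := rshift n (rshift 1 0).

Definition dnet d (i : 'I_d) (u : net R d) : net R d := fun e => pd1 i (u e).

Definition compact_supp_x (u : net R (1 + n)) : Prop :=
  exists2 K : set 'rV[R]_n, compact K & gsupp u `<=` [set z | K (rsubmx z)].

Definition transport_solution (a : 'I_n -> net R (1 + n)) (h : 'I_n)
    (w : net R (1 + n)) : Prop :=
  (dnet i_t w =G fun e z => \sum_j a j e z * dnet (i_x j) w e z) /\
  ((fun e (x : 'rV[R]_n) => w e (row_mx 0 x)) =G fun _ x => (x 0 h)%:C).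

(* The composition a_{1,h}(s, gamma) is performed on representatives; those of
   gamma have to be real valued. *)
Definition characteristic_curve (a : 'I_n -> net R (1 + n))
    (g : 'I_n -> net R (n + (1 + 1))) : Prop :=
  exists (b : 'I_n -> net R (1 + n)) (c : 'I_n -> net R (n + (1 + 1))),
    [/\ forall h, is_repr (a h) (b h),
        forall h, is_repr (g h) (c h) /\ real_net (c h),
        forall h, dnet i_s (c h) =G fun e z =>
          - b h e (row_mx (rsubmx (rsubmx z)) (\row_j complex.Re (c j e z)))
      & forall h, (fun e (z : 'rV[R]_(1 + n)) =>
            c h e (row_mx (rsubmx z) (row_mx (lsubmx z) (lsubmx z))))
          =G fun _ z => (rsubmx z 0 h)%:C].

(* gamma |-> gamma(x, t, 0), as a function of (t, x) *)
Definition at_s0 (g : net R (n + (1 + 1))) : net R (1 + n) :=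
  fun e z => g e (row_mx (rsubmx z) (row_mx (lsubmx z) 0)).

End Transport.

(* A symbol a(x, xi) on R^d x (R^p \ 0) is a function on 'rV_(d + p), only
   looked at for xi != 0. *)
Section Symbols.
Variable R : realType.

Definition S1hg d p (a : 'rV[R]_(d + p) -> R[i]) : Prop :=
  smooth_on [set z | rsubmx z != 0] a /\
  forall (x : 'rV[R]_d) (xi : 'rV[R]_p) (l : R), xi != 0 -> 0 < l ->
    a (row_mx x (l *: xi)) = l%:C * a (row_mx x xi).

Definition seminorm d p (K : set 'rV[R]_d) (al : seq 'I_p) (be : seq 'I_d)
    (a : 'rV[R]_(d + p) -> R[i]) : \bar R :=
  ereal_sup [set r | exists (x : 'rV[R]_d) (xi : 'rV[R]_p),
    [/\ K x, xi != 0 &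
      r = ((enorm xi)^-1 * enorm xi ^+ size al *
           cabs (pd (map (@rshift d p) al ++ map (@lshift d p) be) a
                    (row_mx x xi)))%:E]].

Definition S1hg_net d p (f : net R (d + p)) : Prop :=
  forall e : R, 0 < e <= 1 -> S1hg (f e).

Definition sym_moderate d p (f : net R (d + p)) : Prop :=
  S1hg_net f /\
  forall K, compact K -> forall (al : seq 'I_p) (be : seq 'I_d),
    exists N : nat, bigOeps (fun e => seminorm K al be (f e)) (fun e => e ^- N).

Definition sym_negligible d p (f : net R (d + p)) : Prop :=
  S1hg_net f /\
  forall K, compact K -> forall (al : seq 'I_p) (be : seq 'I_d) (q : nat),
    bigOeps (fun e => seminorm K al be (f e)) (fun e => e ^+ q).

(* equality of generalised symbols in S^1_hg(R^d x R^p \ 0) *)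
Definition sym_eq d p (f g : net R (d + p)) : Prop :=
  sym_negligible (fun e z => f e z - g e z).

Definition sym_slow_scale d p (f : net R (d + p)) : Prop :=
  forall K, compact K -> forall (al : seq 'I_p) (be : seq 'I_d),
    exists2 mu, slow_scale mu &
      bigOeps (fun e => seminorm K al be (f e)) (fun e => cabs (mu e)).

Definition real_symbol_net d p (f : net R (d + p)) : Prop :=
  forall (e : R) (x : 'rV[R]_d) (xi : 'rV[R]_p), 0 < e <= 1 -> xi != 0 ->
    complex.Im (f e (row_mx x xi)) = 0.

End Symbols.

Section Phase.
Variables (R : realType) (n : nat).

(* (y, eta) |-> phi(t, x, eta) - y eta, with z = (t, x) *)
Definition phase' (phi : 'rV[R]_((1 + n) + n) -> R[i]) (z : 'rV[R]_(1 + n)) :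
    'rV[R]_(n + n) -> R[i] :=
  fun w => phi (row_mx z (rsubmx w)) - (dotp (lsubmx w) (rsubmx w))%:C.

Definition grad_inf (phi : 'rV[R]_((1 + n) + n) -> R[i])
    (K' : set 'rV[R]_(1 + n)) (K : set 'rV[R]_n) : \bar R :=
  ereal_inf [set r | exists (z : 'rV[R]_(1 + n)) (y eta : 'rV[R]_n),
    [/\ K' z, K y, eta != 0 &
      r = (\sum_i cabs (grad (phase' phi z)
             (row_mx y ((enorm eta)^-1 *: eta)) 0 i) ^+ 2)%:E]].

Definition phase_net (phi : net R ((1 + n) + n)) : Prop :=
  [/\ sym_moderate phi,
      real_symbol_net phi,
      (forall (e : R) (z : 'rV[R]_(1 + n)) (y eta : 'rV[R]_n),
         0 < e <= 1 -> eta != 0 -> grad (phase' (phi e) z) (row_mx y eta) != 0)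
    & forall (K' : set 'rV[R]_(1 + n)) (K : set 'rV[R]_n),
        compact K' -> compact K ->
        exists2 r : R, 0 < r &
          \forall e \near 0^'+, ((e `^ r)%:E <= grad_inf (phi e) K' K)%E].

Definition generalised_phase (phi : net R ((1 + n) + n)) : Prop :=
  exists2 psi, sym_eq phi psi & phase_net psi.

(* s_eps <> 0 is required since (0 : R)^-1 = 0 *)
Definition slow_scale_generalised_phase (phi : net R ((1 + n) + n)) : Prop :=
  exists2 psi, sym_eq phi psi &
    [/\ phase_net psi,
        sym_slow_scale psi
      & forall (K' : set 'rV[R]_(1 + n)) (K : set 'rV[R]_n),
          compact K' -> compact K ->
          exists2 s : R -> R[i], slow_scale s &
            \forall e \near 0^'+, s e != 0 /\
              (((cabs (s e))^-1)%:E <= grad_inf (psi e) K' K)%E].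

(* sum_h w_h(t, x) eta_h *)
Definition phase_of (w : 'I_n -> net R (1 + n)) : net R ((1 + n) + n) :=
  fun e z => \sum_h w h e (lsubmx z) * (rsubmx z 0 h)%:C.

Definition eikonal_solution (a : 'I_n -> net R (1 + n))
    (phi : net R ((1 + n) + n)) : Prop :=
  sym_eq (dnet (lshift n (i_t n)) phi)
         (fun e z => \sum_j a j e (lsubmx z) * dnet (lshift n (i_x j)) phi e z) /\
  @sym_eq R n n (fun e z => phi e (row_mx (row_mx 0 (lsubmx z)) (rsubmx z)))
                (fun _ z => (dotp (lsubmx z) (rsubmx z))%:C).

End Phase.

(* Main.v *)
(* The phase is linear in eta, so its seminorms are those of the omega_h, the
   eikonal equation is the transport equation of the omega_h, and the derivatives
   of phi - y eta in y, which are -eta, already bound its gradient below by |eta|.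

   The characteristics stay in a compact set: |gamma|^2 is almost stationary in an
   annulus outside the x-support of the coefficients and hence cannot cross it.
   Along s |-> (s, gamma(x, t, s)) the function omega_h has a negligible derivative;
   comparing s = t with s = 0 gives omega_h(t, x) - gamma_h(x, t, 0) = O(eps^q) on
   compact sets, and Landau's interpolation inequality extends this to all
   derivatives because the difference is moderate.

   For slow scale bounds, the commutator of a derivative of order m in x with
   sum_j a_j d_j consists of the first derivatives of the a_j times derivatives of
   order m, and of slow scale factors times derivatives of lower order. Gronwall's
   inequality along the characteristics then gives, by induction on m, slow scale
   bounds on all x-derivatives of omega_h, since exp(C log mu) is again slow scale;
   derivatives in t follow from the equation. *)
Require Import Defs.
From HB Require Import structures.
From mathcomp Require Import all_boot all_order all_algebra.
From mathcomp Require Import complex.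
From mathcomp Require Import all_classical all_reals all_analysis.
From mathcomp Require Import ring lra.
Set Implicit Arguments.
Unset Strict Implicit.
Unset Printing Implicit Defensive.
Import Order.TTheory GRing.Theory Num.Theory.
Import numFieldNormedType.Exports.
Local Open Scope classical_set_scope.
Local Open Scope ring_scope.
Local Open Scope complex_scope.

(** * Partial derivatives on R^d *)


Section RealCalculus.
Variable R : realType.

(** Each hypothesis supplies its own representative, and a representative satisfies its equation
    only up to a negligible error. The estimates are therefore made on nets of real functions whose
    equations hold up to such errors, so that representatives can be exchanged. The bound on the
    flow has to come before everything else: all the bounds on nets are local in (t, x), and they
    can be applied at (s, gamma) only once this point is known to stay in a ball independent of e.
    The commutators couple all derivatives of the same order, so Gronwall's inequality is applied to
    the sum of their squares, which is differentiable along the flow where a sum of absolute values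
    need not be. Its exponent is a bound on the first x-derivatives of the coefficients. A slow
    scale bound would not do there: (log(1/e))^2 is a slow scale net whose exponential is not even
    moderate. This is where the slow scale logarithmic type enters. *)

Lemma differentiable_row (V : normedModType R) d (p : V -> 'rV[R]_d) x :
  (forall i, differentiable (fun y => p y 0 i) x) -> differentiable p x.
Proof.
move=> dp.
have -> : p = \sum_i (fun y => p y 0 i *: (delta_mx 0 i : 'rV[R]_d)).
  by apply/funext => y; rewrite fct_sumE {1}[p y]row_sum_delta.
by apply: differentiable_sum => i; exact: differentiableZl.
Qed.

Lemma norm_coord_le d (x : 'rV[R]_d) i : `|x 0 i| <= `|x|.
Proof. by rewrite [leRHS]/Num.Def.normr/= mx_normrE; exact: (le_bigmax _ _ (0, i)). Qed.

Lemma norm_row_le d (x : 'rV[R]_d) M :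
  0 <= M -> (forall i, `|x 0 i| <= M) -> `|x| <= M.
Proof.
move=> M0 xM; rewrite [leLHS]/Num.Def.normr/= mx_normrE.
apply: bigmax_le => // -[j i] _.
by rewrite ord1.
Qed.

Lemma norm_delta_le d (i : 'I_d) : `|delta_mx 0 i : 'rV[R]_d| <= 1.
Proof.
by apply: norm_row_le => // j; rewrite mxE; case: (_ && _); rewrite ?normr1 ?normr0.
Qed.

Lemma is_derive_curve d (F : 'rV[R]_d -> R) (p : R -> 'rV[R]_d) dp (s : R) :
  differentiable F (p s) ->
  (forall i, is_derive s 1 (fun r => p r 0 i) (dp i)) ->
  is_derive s 1 (fun r => F (p r))
    (\sum_i dp i * 'D_(delta_mx 0 i) F (p s)).
Proof.
move=> dF pdp.
have pd i : differentiable (fun r => p r 0 i) s.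
  by apply/derivable1_diffP; have [] := pdp i.
have dfp : differentiable p s by exact: differentiable_row.
have dFp : differentiable (F \o p) s by exact: differentiable_comp.
apply: DeriveDef; first exact/derivable1_diffP.
rewrite (deriveE _ dFp) diff_comp//= -(deriveE _ dfp).
have dpe : 'D_1 p s = \sum_i dp i *: delta_mx 0 i.
  rewrite derive_mx; last exact/derivable1_diffP.
  rewrite [LHS]row_sum_delta; apply: eq_bigr => i _.
  by rewrite mxE; have [_ ->] := pdp i.
rewrite dpe linear_sum; apply: eq_bigr => i _ /=.
by rewrite linearZ/= (deriveE _ dF).
Qed.

Definition dd d (i : 'I_d) (f : 'rV[R]_d -> R) : 'rV[R]_d -> R :=
  fun x => 'D_(delta_mx 0 i) f x.

Definition dds d (s : seq 'I_d) (f : 'rV[R]_d -> R) : 'rV[R]_d -> R :=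
  foldr (@dd d) f s.

Definition rsmooth d (f : 'rV[R]_d -> R) : Prop :=
  forall (s : seq 'I_d) x, differentiable (dds s f) x.

Lemma dds_cat d (s r : seq 'I_d) f : dds (s ++ r) f = dds s (dds r f).
Proof. exact: foldr_cat. Qed.

Lemma dds_rcons d (s : seq 'I_d) i f : dds (rcons s i) f = dds s (dd i f).
Proof. by rewrite -cats1 dds_cat. Qed.

Lemma rsmooth_differentiable d (f : 'rV[R]_d -> R) x :
  rsmooth f -> differentiable f x.
Proof. by move=> /(_ [::] x). Qed.

Lemma rsmooth_dds d (s : seq 'I_d) (f : 'rV[R]_d -> R) : rsmooth f -> rsmooth (dds s f).
Proof. by move=> sf r x; rewrite -dds_cat; exact: sf. Qed.

Lemma rsmooth_dd d (i : 'I_d) f : rsmooth f -> rsmooth (dd i f).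
Proof. exact: (@rsmooth_dds _ [:: i]). Qed.

Lemma rsmooth_rec d (f : 'rV[R]_d -> R) :
  (forall x, differentiable f x) -> (forall i, rsmooth (dd i f)) -> rsmooth f.
Proof.
move=> df sdf s; case/lastP: s => [|s i] x; first exact: df.
by rewrite dds_rcons; exact: sdf.
Qed.

Lemma ddD d (i : 'I_d) (f g : 'rV[R]_d -> R) x :
  differentiable f x -> differentiable g x ->
  dd i (fun y => f y + g y) x = dd i f x + dd i g x.
Proof. by move=> df dg; rewrite /dd deriveD//; exact: diff_derivable. Qed.

Lemma ddN d (i : 'I_d) (f : 'rV[R]_d -> R) x : differentiable f x ->
  dd i (fun y => - f y) x = - dd i f x.
Proof. by move=> df; rewrite /dd deriveN//; exact: diff_derivable. Qed.

Lemma ddM d (i : 'I_d) (f g : 'rV[R]_d -> R) x :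
  differentiable f x -> differentiable g x ->
  dd i (fun y => f y * g y) x = dd i f x * g x + f x * dd i g x.
Proof.
move=> df dg; rewrite /dd deriveM; [|exact: diff_derivable..].
by rewrite addrC [g x *: _]mulrC.
Qed.

Lemma dd_cst d (i : 'I_d) (c : R) : dd i (fun=> c) = fun=> 0.
Proof. by apply/funext => x; exact: derive_cst. Qed.

Lemma ddsD d (s : seq 'I_d) (f g : 'rV[R]_d -> R) : rsmooth f -> rsmooth g ->
  dds s (fun y => f y + g y) = fun x => dds s f x + dds s g x.
Proof.
move=> sf sg; elim: s => //= i s ->.
by apply/funext => x; rewrite ddD.
Qed.

Lemma ddsN d (s : seq 'I_d) (f : 'rV[R]_d -> R) : rsmooth f ->
  dds s (fun y => - f y) = fun x => - dds s f x.
Proof.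
by move=> sf; elim: s => //= i s ->; apply/funext => x; rewrite ddN.
Qed.

Lemma rsmooth_cst d (c : R) : rsmooth (fun _ : 'rV[R]_d => c).
Proof.
move=> s x; suff [c' ->] : exists c', dds s (fun _ : 'rV[R]_d => c) = fun=> c'.
  exact: differentiable_cst.
elim: s => [|i s [c' IH]] /=; first by exists c.
by exists 0; rewrite IH dd_cst.
Qed.

Lemma dds_cst0 d (s : seq 'I_d) : dds s (fun=> 0) = fun=> 0.
Proof. by elim: s => //= i s ->; rewrite dd_cst. Qed.

Lemma rsmoothD d (f g : 'rV[R]_d -> R) :
  rsmooth f -> rsmooth g -> rsmooth (fun x => f x + g x).
Proof.
by move=> sf sg s x; rewrite ddsD//; exact: differentiableD (sf s x) (sg s x).
Qed.

Lemma rsmoothN d (f : 'rV[R]_d -> R) : rsmooth f -> rsmooth (fun x => - f x).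
Proof. by move=> sf s x; rewrite ddsN//; exact: differentiableN (sf s x). Qed.

Lemma rsmoothB d (f g : 'rV[R]_d -> R) :
  rsmooth f -> rsmooth g -> rsmooth (fun x => f x - g x).
Proof. by move=> sf sg; apply: rsmoothD => //; exact: rsmoothN. Qed.

Lemma ddsB d (s : seq 'I_d) (f g : 'rV[R]_d -> R) : rsmooth f -> rsmooth g ->
  dds s (fun y => f y - g y) = fun x => dds s f x - dds s g x.
Proof. by move=> sf sg; rewrite ddsD ?ddsN//; exact: rsmoothN. Qed.

(** Finite order makes closure under products provable: the derivative of a product is a sum of two
    products of class one lower, so induction on k applies, whereas induction on a sequence of
    derivatives leaves the form of a product at once. *)
Fixpoint Ck d (k : nat) (f : 'rV[R]_d -> R) : Prop :=
  (forall x, differentiable f x) /\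
  if k is k'.+1 then forall i, Ck k' (dd i f) else True.

Lemma rsmoothP d (f : 'rV[R]_d -> R) : rsmooth f <-> forall k, Ck k f.
Proof.
split=> [sf k|Cf s x].
  elim: k f sf => [|k IH] f sf; split=> [x|]//; first exact: (sf [::]).
    exact: (sf [::]).
  by move=> i; exact/IH/rsmooth_dd.
elim/last_ind: s f Cf => [|s i IH] f Cf; first by have [+ _] := Cf 0; exact.
by rewrite dds_rcons; apply: IH => k; have [_] := Cf k.+1; exact.
Qed.

Lemma CkD d k (f g : 'rV[R]_d -> R) :
  Ck k f -> Ck k g -> Ck k (fun x => f x + g x).
Proof.
elim: k f g => [|k IH] f g [df Cf] [dg Cg]; split=> [x|]//;
  try exact: differentiableD (df x) (dg x).
move=> i; have -> : dd i (fun x => f x + g x) = fun x => dd i f x + dd i g x.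
  by apply/funext => x; rewrite ddD.
exact: (IH _ _ (Cf i) (Cg i)).
Qed.

Lemma Ck_pred d k (f : 'rV[R]_d -> R) : Ck k.+1 f -> Ck k f.
Proof.
elim: k f => [|k IH] f [df Cf]; split=> // i.
exact/IH/Cf.
Qed.

Lemma CkM d k (f g : 'rV[R]_d -> R) :
  Ck k f -> Ck k g -> Ck k (fun x => f x * g x).
Proof.
elim: k f g => [|k IH] f g Cf Cg; have [df Cdf] := Cf; have [dg Cdg] := Cg;
  split=> [x|]//; try exact: differentiableM (df x) (dg x).
move=> i.
have -> : dd i (fun x => f x * g x) =
    fun x => dd i f x * g x + f x * dd i g x.
  by apply/funext => x; rewrite ddM.
apply: CkD; [exact: IH (Cdf i) (Ck_pred Cg)|exact: IH (Ck_pred Cf) (Cdg i)].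
Qed.

Lemma rsmoothM d (f g : 'rV[R]_d -> R) :
  rsmooth f -> rsmooth g -> rsmooth (fun x => f x * g x).
Proof.
by move=> /rsmoothP sf /rsmoothP sg; apply/rsmoothP => k; exact: CkM.
Qed.

Lemma rsmooth_sum (I : Type) (r : seq I) (P : pred I) d
    (f : I -> 'rV[R]_d -> R) : (forall i, rsmooth (f i)) ->
  rsmooth (fun x => \sum_(i <- r | P i) f i x).
Proof.
move=> sf; elim: r => [|i r IH].
  by under eq_fun do rewrite big_nil; exact: rsmooth_cst.
under eq_fun do rewrite big_cons.
by case: (P i) => //; exact: rsmoothD.
Qed.

Lemma dds_sum (I : Type) (r : seq I) (P : pred I) d (s : seq 'I_d)
    (f : I -> 'rV[R]_d -> R) : (forall i, rsmooth (f i)) ->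
  dds s (fun x => \sum_(i <- r | P i) f i x) =
  fun x => \sum_(i <- r | P i) dds s (f i) x.
Proof.
move=> sf; elim: r => [|i r IH].
  by under eq_fun do rewrite big_nil;
     rewrite dds_cst0; apply/funext => x; rewrite big_nil.
under eq_fun do rewrite big_cons.
apply/funext => x; rewrite big_cons; case: (P i); last by rewrite IH.
by rewrite ddsD ?IH//; exact: rsmooth_sum.
Qed.

Lemma dd_coord d (j i : 'I_d) (x : 'rV[R]_d) :
  dd j (fun y : 'rV[R]_d => y 0 i) x = (i == j)%:R.
Proof.
rewrite /dd /derive; apply: cvg_lim => //.
apply: cvg_near_cst; near=> h => /=.
rewrite !mxE eqxx/= addrK /= /GRing.scale/= mulrA mulVf ?mul1r//.
by near: h; exact: nbhs_dnbhs_neq.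
Unshelve. all: by end_near. Qed.

Lemma rsmooth_coord d (i : 'I_d) : rsmooth (fun x : 'rV[R]_d => x 0 i).
Proof.
apply: rsmooth_rec => [x|j]; first exact: differentiable_coord.
rewrite (_ : dd j _ = fun=> (i == j)%:R); first exact: rsmooth_cst.
by apply/funext => x; rewrite dd_coord.
Qed.

(** The two difference quotients coincide for every increment, so the identity also covers the
    default value of a derivative that does not exist. *)
Lemma dd_affine d p (i : 'I_d) (l : 'rV[R]_d -> 'rV[R]_p) v f x :
  (forall h y, l (h *: delta_mx 0 i + y) = h *: v + l y) ->
  dd i (fun y => f (l y)) x = 'D_v f (l x).
Proof.
move=> lE; pose q (h : R) : R := h^-1 *: (f (l (h *: delta_mx 0 i + x)) - f (l x)).
rewrite -[LHS]/(lim (q @ 0^')).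
rewrite (_ : q = fun h => h^-1 *: (f (h *: v + l x) - f (l x)))//.
by apply/funext => h; rewrite /q lE.
Qed.

(* Affine maps whose linear part sends every basis vector to a basis vector or
   to 0: pulling back along them turns iterated derivatives into iterated
   derivatives or 0, with no sum over multi-indices. *)
Definition coord_map d p (sg : 'I_d -> option 'I_p)
    (l : 'rV[R]_d -> 'rV[R]_p) : Prop :=
  (forall x, differentiable l x) /\
  forall i h y, l (h *: delta_mx 0 i + y) =
    h *: (if sg i is Some k then delta_mx 0 k else 0) + l y.

Lemma dd_coord_map d p (sg : 'I_d -> option 'I_p) l f i :
  coord_map sg l ->
  dd i (fun x => f (l x)) =
  fun x => if sg i is Some k then dd k f (l x) else 0.
Proof.
move=> [_ lE]; apply/funext => x; rewrite (dd_affine _ _ (lE i)).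
by case: (sg i) => // ; rewrite derive0.
Qed.

Lemma dds_coord_map d p (sg : 'I_d -> option 'I_p) l s :
  coord_map sg l ->
  (exists r, forall f, dds s (fun x => f (l x)) = fun x => dds r f (l x)) \/
  forall f, dds s (fun x => f (l x)) = fun=> 0.
Proof.
move=> cl; elim: s => [|i s [[r IH]|IH]] /=; first by left; exists [::].
  case sgi : (sg i) => [k|].
    by left; exists (k :: r) => f; rewrite IH (dd_coord_map _ _ cl) sgi.
  by right => f; rewrite IH (dd_coord_map _ _ cl) sgi.
by right => f; rewrite IH dd_cst.
Qed.

Lemma rsmooth_coord_map d p (sg : 'I_d -> option 'I_p) l f :
  coord_map sg l -> rsmooth f -> rsmooth (fun x => f (l x)).
Proof.
move=> cl sf s x; have [[r ->]|->] := dds_coord_map s cl.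
  by apply: (@differentiable_comp _ _ _ _ l (dds r f)); [case: cl|exact: sf].
exact: differentiable_cst.
Qed.

Lemma mvt_line (f df : R -> R) (a b : R) :
  (forall x, is_derive x (1 : R) f (df x)) ->
  exists c, [/\ Num.min a b <= c, c <= Num.max a b
                & f b - f a = df c * (b - a)].
Proof.
move=> fd; have cf x y : {within `[x, y], continuous f}.
  by apply: derivable_within_continuous => z _; have [] := fd z.
wlog ab : a b / a <= b.
  move=> H; have [ab|/ltW ba] := leP a b.
    by have := H _ _ ab; rewrite min_l// max_r.
  have := H _ _ ba; rewrite min_l// max_r// => -[c [c1 c2 ce]].
  by exists c; split=> //; rewrite -opprB ce -mulrN opprB.
have [c + ce] := MVT_segment ab (fun x _ => fd x) (cf a b).
by rewrite in_itv/= => /andP[ac cb]; exists c; rewrite min_l// max_r.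
Qed.

Lemma is_derive_line d (f : 'rV[R]_d -> R) z v (s : R) :
  (forall x, differentiable f x) ->
  is_derive s 1 (fun r => f (z + r *: v))
    (\sum_i v 0 i * dd i f (z + s *: v)).
Proof.
move=> df; apply: (@is_derive_curve d f (fun r => z + r *: v) (v 0)) => // i.
under eq_fun do rewrite !mxE.
apply: is_derive_eq; rewrite add0r.
by rewrite scaler0 add0r mul1r /GRing.scale/= mulr1.
Qed.

Lemma mvt_segment d (f : 'rV[R]_d -> R) x y : (forall z, differentiable f z) ->
  exists th, [/\ 0 <= th, th <= 1 &
    f y - f x = \sum_i (y - x) 0 i * dd i f (x + th *: (y - x))].
Proof.
move=> df.
have [th [th0 th1]] := mvt_line 0 1 (fun s => is_derive_line x (y - x) s df).
rewrite scale0r scale1r addr0 [x + (y - x)]addrC subrK subr0 mulr1 => e.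
by exists th; split => //; move: th0 th1; rewrite ?min_l ?max_r.
Qed.

Lemma mvt_coord d (i : 'I_d) (f : 'rV[R]_d -> R) z h :
  (forall x, differentiable f x) ->
  exists th, `|th| <= `|h| /\
    f (z + h *: delta_mx 0 i) - f z = h * dd i f (z + th *: delta_mx 0 i).
Proof.
move=> df; set v := delta_mx 0 i : 'rV[R]_d.
have [c [c1 c2]] := mvt_line 0 h (fun s => is_derive_line z v s df).
rewrite scale0r addr0 subr0 (bigD1 i)//= big1 ?addr0 => [|k /negPf ki]; last first.
  by rewrite mxE eqxx ki mul0r.
rewrite mxE !eqxx mul1r [_ * h]mulrC => e; exists c; split=> //.
move: c1 c2; have [h0|h0] := leP 0 h => ? ?.
  by rewrite !ger0_norm; lra.
by rewrite !ler0_norm; lra.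
Qed.

(** The difference quotient is symmetric in i and j while the right-hand side orders the two
    derivatives; used in both orders, this gives Schwarz's theorem. The mean value theorem is
    applied in direction i to the increment of f in direction j, then in direction j. *)
Lemma second_difference d (i j : 'I_d) (f : 'rV[R]_d -> R) z h :
  h != 0 -> rsmooth f ->
  exists th th', [/\ `|th| <= `|h|, `|th'| <= `|h| &
    (f (z + h *: delta_mx 0 i + h *: delta_mx 0 j) - f (z + h *: delta_mx 0 i)
     - f (z + h *: delta_mx 0 j) + f z) / h ^+ 2 =
    dd j (dd i f) (z + th *: delta_mx 0 i + th' *: delta_mx 0 j)].
Proof.
move=> h0 sf.
set ei := delta_mx 0 i; set ej := delta_mx 0 j : 'rV[R]_d.
have cl : coord_map Some (fun x => x + h *: ej).
  split=> [x|k r y]; last by rewrite addrA.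
  exact: differentiableD.
pose g x := f (x + h *: ej) - f x.
have dg x : differentiable g x.
  apply: rsmooth_differentiable; apply: rsmoothB => //.
  exact: (rsmooth_coord_map cl).
have [th [thh e1]] := mvt_coord i z h dg.
have dif x : differentiable (dd i f) x.
  exact/rsmooth_differentiable/rsmooth_dd.
have [th' [thh' e2]] := mvt_coord j (z + th *: ei) h dif.
exists th, th'; split=> //.
have gE : dd i g (z + th *: ei) =
    dd i f (z + th *: ei + h *: ej) - dd i f (z + th *: ei).
  rewrite /g ddD ?ddN ?(dd_coord_map _ _ cl)//; try exact: rsmooth_differentiable.
    exact/rsmooth_differentiable/(rsmooth_coord_map cl).
  exact/rsmooth_differentiable/rsmoothN.
move: e1; rewrite gE e2 /g -/ei => e1.
apply: (mulIf (expf_neq0 2 h0)); rewrite divfK ?expf_neq0//.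
by rewrite expr2 [RHS]mulrC -mulrA -e1; ring.
Qed.

Lemma dist_triangle_half (A B C C' e : R) :
  `|A - C| < e / 2 -> `|B - C'| < e / 2 -> C = C' -> `|A - B| <= e.
Proof.
move=> AC + CC'; rewrite -CC' distrC => CB.
have -> : A - B = (A - C) + (C - B) by ring.
by rewrite (le_trans (ler_normD _ _))// [leRHS]splitr lerD ?ltW.
Qed.

Lemma dd_comm d (i j : 'I_d) (f : 'rV[R]_d -> R) : rsmooth f ->
  dd i (dd j f) = dd j (dd i f).
Proof.
move=> sf; apply/funext => z.
have cont k l : {for z, continuous (dd k (dd l f))}.
  exact/differentiable_continuous/rsmooth_differentiable/rsmooth_dd/rsmooth_dd.
apply/eqP; rewrite -subr_eq0 -normr_le0; apply/ler_addgt0Pr => e e0.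
rewrite add0r; have e20 : 0 < e / 2 by rewrite divr_gt0.
have near k l : exists2 r, 0 < r & forall y, `|z - y| < r ->
    `|dd k (dd l f) z - dd k (dd l f) y| < e / 2.
  have /cvgrPdist_lt /(_ _ e20)/nbhs_normP [r /= r0 H] := cont k l.
  by exists r.
have [r1 r10 H1] := near i j; have [r2 r20 H2] := near j i.
(* Two displacements of length at most h stay strictly within both radii. *)
pose h := Num.min r1 r2 / 3.
have r0 : 0 < Num.min r1 r2 by rewrite lt_min r10.
have h0 : 0 < h by rewrite divr_gt0.
have close k l th th' : `|th| <= `|h| -> `|th'| <= `|h| ->
    `|z - (z + th *: delta_mx 0 k + th' *: delta_mx 0 l)| < Num.min r1 r2.
  move=> thh thh'; rewrite -addrA opprD addNKr -normrN opprK.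
  rewrite (le_lt_trans (ler_normD _ _))// !normrZ.
  rewrite (gtr0_norm h0) in thh thh'.
  have small (c : R) (m : 'I_d) : `|c| <= h -> `|c| * `|delta_mx 0 m : 'rV[R]_d| <= h.
    by move=> ch; rewrite -[h]mulr1 ler_pM// norm_delta_le.
  have := small _ k thh; have := small _ l thh'.
  have : h = Num.min r1 r2 / 3 by [].
  lra.
have [th [th' [t1 t2 e1]]] := second_difference j i z (lt0r_neq0 h0) sf.
have [ta [ta' [t3 t4 e2]]] := second_difference i j z (lt0r_neq0 h0) sf.
have e12 : dd i (dd j f) (z + th *: delta_mx 0 j + th' *: delta_mx 0 i) =
           dd j (dd i f) (z + ta *: delta_mx 0 i + ta' *: delta_mx 0 j).
  rewrite -e1 -e2; congr (_ / _); rewrite [z + _ + _]addrAC; ring.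
have [m1 m2] : Num.min r1 r2 <= r1 /\ Num.min r1 r2 <= r2.
  by split; rewrite ge_min lexx ?orbT.
have c1 := H1 _ (lt_le_trans (close j i _ _ t1 t2) m1).
have c2 := H2 _ (lt_le_trans (close i j _ _ t3 t4) m2).
exact: dist_triangle_half c1 c2 e12.
Qed.

Lemma dds_comm d (i : 'I_d) s (f : 'rV[R]_d -> R) : rsmooth f ->
  dd i (dds s f) = dds s (dd i f).
Proof.
move=> sf; elim: s => //= j s <-.
by rewrite dd_comm//; exact: rsmooth_dds.
Qed.

Lemma dds_perm d (s r : seq 'I_d) (f : 'rV[R]_d -> R) : rsmooth f ->
  perm_eq s r -> dds s f = dds r f.
Proof.
move=> sf; elim: s r => [|i s IH] r.
  by move=> /perm_size/esym/eqP/nilP ->.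
move=> /[dup] /perm_mem /(_ i); rewrite mem_head => /esym ir.
case/splitPr: ir => r1 r2.
rewrite perm_sym -cat1s perm_catCA/= perm_cons perm_sym => /IH sr.
by rewrite /= sr !dds_cat/= dds_comm//; exact: rsmooth_dds.
Qed.

End RealCalculus.

(** * Asymptotic scales and real valued nets *)


Section Scales.
Variable R : realType.
Implicit Types x y : R -> R.

Lemma near0_le1 : \forall e \near (0:R)^'+, 0 < e <= 1.
Proof.
near=> e; apply/andP; split; near: e; first exact: nbhs_right_gt.
exact: nbhs_right_le.
Unshelve. all: by end_near. Qed.

Lemma near0_mul_le (c : R) : \forall e \near (0:R)^'+, c * e <= 1.
Proof.
have [c0|c0] := leP c 0.
  apply: filterS near0_le1 => e /andP[e0 _].
  by rewrite (le_trans _ ler01)// mulr_le0_ge0// ltW.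
have ci : 0 < c^-1 by rewrite invr_gt0.
apply: filterS (nbhs_right_le ci) => e ec.
by rewrite mulrC -ler_pdivlMr// div1r.
Qed.

Lemma normr_expR (c : R) : `|expR c| = expR c.
Proof. by rewrite ger0_norm// expR_ge0. Qed.

(** The bounds carry the constant 1 in place of O: near 0 a constant is absorbed into one more power
    of e or, for [slow_s], by doubling the exponent. *)
Definition mod_s x := exists N : nat, \forall e \near 0^'+, `|x e| <= e ^- N.
Definition neg_s x := forall q : nat, \forall e \near 0^'+, `|x e| <= e ^+ q.
Definition slow_s x :=
  forall N : nat, \forall e \near 0^'+, `|x e| ^+ N <= e^-1.
(* logarithms of slow scale nets: exactly what Gronwall's inequality turns into
   a slow scale net *)
Definition log_s x := forall C : nat, slow_s (fun e => expR (C%:R * `|x e|)).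

Definition solid (X : (R -> R) -> Prop) := forall x y, X y ->
  (\forall e \near 0^'+, `|x e| <= `|y e|) -> X x.

Definition additive_s (X : (R -> R) -> Prop) :=
  forall x y, X x -> X y -> X (fun e => x e + y e).

Lemma neg_solid : solid neg_s.
Proof.
by move=> x y yN xy q; apply: filterS2 xy (yN q) => e; exact: le_trans.
Qed.

Lemma slow_solid : solid slow_s.
Proof.
move=> x y yN xy N; apply: filterS2 xy (yN N) => e xy yN'.
by rewrite (le_trans _ yN')// lerXn2r// nnegrE.
Qed.

Lemma log_solid : solid log_s.
Proof.
move=> x y yl xy C; apply: (slow_solid (yl C)).
apply: filterS xy => e xy; rewrite !normr_expR.
by rewrite ler_expR ler_wpM2l.
Qed.

Lemma neg_sub_slow x : neg_s x -> slow_s x.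
Proof.
move=> xn N; apply: filterS2 (xn 0) near0_le1 => e xe /andP[e0 e1].
rewrite expr0 in xe.
by rewrite (@le_trans _ _ 1)// ?invf_ge1// exprn_ile1.
Qed.

Lemma slow_sub_mod x : slow_s x -> mod_s x.
Proof. by move=> /(_ 1) xs; exists 1. Qed.

Lemma slowM x y : slow_s x -> slow_s y -> slow_s (fun e => x e * y e).
Proof.
move=> xs ys N.
(* The exponent 2 N bounds the square of |x y|^N by e^-2; the root is taken afterwards. *)
apply: filterS3 near0_le1 (xs (N * 2)%N) (ys (N * 2)%N) => e /andP[e0 _] xe ye.
have ei : 0 <= e^-1 by rewrite invr_ge0 ltW.
rewrite normrM exprMn -(ler_pXn2r (_ : 0 < 2)%N) ?nnegrE ?mulr_ge0 ?exprn_ge0//.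
by rewrite exprMn -!exprM [leRHS]expr2 ler_pM// exprn_ge0.
Qed.

Lemma slow_cst (c : R) : slow_s (fun=> c).
Proof.
move=> N; apply: filterS2 near0_le1 (near0_mul_le (`|c| ^+ N)) => e /andP[e0 e1].
by rewrite -ler_pdivlMr// div1r.
Qed.

Lemma slowD : additive_s slow_s.
Proof.
move=> x y xs ys; pose m e := Num.max `|x e| `|y e|.
have ms : slow_s m.
  move=> N; apply: filterS2 (xs N) (ys N) => e; rewrite /m.
  by have [_|_] := leP `|x e| `|y e|; rewrite normr_id.
apply: (slow_solid (slowM (slow_cst 2) ms)); apply: nearW => e.
have m0 : 0 <= m e by rewrite le_max normr_ge0.
rewrite normrM (ger0_norm m0) normr_nat (le_trans (ler_normD _ _))//.
rewrite mulr2n mulrDl mul1r.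
by rewrite lerD// le_max lexx ?orbT.
Qed.

Lemma negD : additive_s neg_s.
Proof.
move=> x y xs ys q.
apply: filterS3 (filterI near0_le1 (near0_mul_le 2)) (xs q.+1) (ys q.+1).
move=> e [/andP[e0 e1] e2] xe ye.
rewrite (le_trans (ler_normD _ _))// (le_trans (lerD xe ye))//.
rewrite -mulr2n -mulr_natl exprS mulrA -[leRHS]mul1r ler_wpM2r//.
by rewrite exprn_ge0// ltW.
Qed.

Lemma expVn_le (e : R) (N M : nat) : 0 < e <= 1 -> (N <= M)%N -> e ^- N <= e ^- M.
Proof.
move=> /andP[e0 e1] NM; rewrite lef_pV2 ?posrE ?exprn_gt0//.
by rewrite ler_wiXn2l// ltW.
Qed.

Lemma modM x y : mod_s x -> mod_s y -> mod_s (fun e => x e * y e).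
Proof.
move=> [N xN] [M yM]; exists (N + M)%N; apply: filterS2 xN yM => e xN yM.
by rewrite normrM exprD invfM ler_pM.
Qed.

Lemma modD : additive_s mod_s.
Proof.
move=> x y [N xN] [M yM]; exists (N + M).+1.
apply: filterS3 (filterI near0_le1 (near0_mul_le 2)) xN yM.
move=> e [e01 e2] xe ye; have /andP[e0 e1] := e01.
rewrite (le_trans (ler_normD _ _))//.
have := le_trans xe (expVn_le e01 (leq_addr M N)).
have := le_trans ye (expVn_le e01 (leq_addl N M)).
have : 0 < e ^- (N + M) by rewrite invr_gt0 exprn_gt0.
rewrite exprS invfM; set t := e ^- (N + M) => t0 yt xt.
rewrite (le_trans (lerD xt yt))// -mulr2n -mulr_natl ler_pM2r//.
by rewrite -ler_pdivlMr// div1r in e2.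
Qed.

Lemma neg_mul_mod x y : neg_s x -> mod_s y -> neg_s (fun e => x e * y e).
Proof.
move=> xn [N yN] q; apply: filterS3 near0_le1 (xn (q + N)%N) yN.
move=> e /andP[e0 e1] xe ye; rewrite normrM.
rewrite (le_trans (ler_pM _ _ xe ye))// exprD mulfK//.
by rewrite expf_neq0// gt_eqF.
Qed.

Lemma neg_sub_log x : neg_s x -> log_s x.
Proof.
move=> xn C; apply: (slow_solid (slow_cst (expR C%:R))).
apply: filterS (xn 0) => e xe; rewrite !normr_expR ler_expR.
by rewrite -[leRHS]mulr1 ler_wpM2l.
Qed.

Lemma logD : additive_s log_s.
Proof.
move=> x y xl yl C; apply: (slow_solid (slowM (xl C) (yl C))).
apply: nearW => e; rewrite normrM !normr_expR -expRD ler_expR.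
by rewrite -mulrDr ler_wpM2l// ler_normD.
Qed.

Lemma logMn x (c : nat) : log_s x -> log_s (fun e => c%:R * x e).
Proof.
move=> xl C; apply: (slow_solid (xl (C * c)%N)).
by apply: nearW => e; rewrite normrM normr_nat natrM mulrA.
Qed.

Lemma log_cst (c : R) : log_s (fun=> c).
Proof. by move=> C; exact: slow_cst. Qed.

Lemma log_exp x (C : nat) : log_s x -> slow_s (fun e => expR (C%:R * x e)).
Proof.
move=> xl; apply: (slow_solid (xl C)); apply: nearW => e.
by rewrite !normr_expR ler_expR ler_wpM2l// ler_norm.
Qed.

End Scales.

Section Nets.
Variable R : realType.
Implicit Types X Y Z : (R -> R) -> Prop.

Definition rnet d := R -> 'rV[R]_d -> R.

(** Balls about 0 stand for all compact sets. The bounding net may depend on the radius M but not on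
    z; a negative M gives an empty condition. *)
Definition bnd d X (f : rnet d) := forall M : R, exists2 x, X x &
  \forall e \near 0^'+, forall z, `|z| <= M -> `|f e z| <= x e.

Definition rsmooth_net d (f : rnet d) := forall e : R, 0 < e <= 1 -> rsmooth (f e).

Definition allb d X (f : rnet d) :=
  rsmooth_net f /\ forall s, bnd X (fun e => dds s (f e)).

Lemma bnd_sub d X Y (f : rnet d) : (forall x, X x -> Y x) -> bnd X f -> bnd Y f.
Proof. by move=> XY Xf M; have [x /XY ? ?] := Xf M; exists x. Qed.

Lemma bnd_le d X (f g : rnet d) : bnd X g ->
  (\forall e \near 0^'+, forall z, `|f e z| <= `|g e z|) -> bnd X f.
Proof.
move=> Xg fg M; have [x Xx gx] := Xg M; exists x => //.
by apply: filterS2 fg gx => e fg gx z /gx; exact: le_trans.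
Qed.

Lemma bnd_eq d X (f g : rnet d) :
  (forall e, 0 < e <= 1 -> f e =1 g e) -> bnd X f -> bnd X g.
Proof.
move=> fg Xf; apply: (bnd_le Xf); apply: filterS (near0_le1 R) => e e01 z.
by rewrite fg.
Qed.

Lemma bndD d X (f g : rnet d) : additive_s X ->
  bnd X f -> bnd X g -> bnd X (fun e z => f e z + g e z).
Proof.
move=> Xadd Xf Xg M; have [[x Xx fx] [y Xy gy]] := (Xf M, Xg M).
exists (fun e => x e + y e); first exact: Xadd.
apply: filterS2 fx gy => e fx gy z zM.
by rewrite (le_trans (ler_normD _ _))// lerD ?fx ?gy.
Qed.

Lemma bndN d X (f : rnet d) : bnd X f -> bnd X (fun e z => - f e z).
Proof.
by move=> Xf; apply: (bnd_le Xf); apply: nearW => e z; rewrite normrN.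
Qed.

Lemma bndM d X Y Z (f g : rnet d) :
  (forall x y, X x -> Y y -> Z (fun e => x e * y e)) ->
  bnd X f -> bnd Y g -> bnd Z (fun e z => f e z * g e z).
Proof.
move=> XYZ Xf Yg M; have [[x Xx fx] [y Yy gy]] := (Xf M, Yg M).
exists (fun e => x e * y e); first exact: XYZ.
apply: filterS2 fx gy => e fx gy z zM.
by rewrite normrM ler_pM ?fx ?gy.
Qed.

Lemma bnd_sum d X (I : Type) (r : seq I) (f : I -> rnet d) :
  X (fun=> 0) -> additive_s X -> (forall i, bnd X (f i)) ->
  bnd X (fun e z => \sum_(i <- r) f i e z).
Proof.
move=> X0 Xadd Xf; elim: r => [|i r IH].
  by move=> M; exists (fun=> 0) => //; apply: nearW => e z _; rewrite big_nil normr0.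
apply: (@bnd_le _ _ _ (fun e z => f i e z + \sum_(j <- r) f j e z)).
  exact: bndD.
by apply: nearW => e z; rewrite big_cons.
Qed.

Lemma neg_s0 : neg_s (fun=> 0 : R).
Proof.
move=> q; apply: filterS (near0_le1 R) => e /andP[e0 _].
by rewrite normr0 exprn_ge0// ltW.
Qed.

Lemma mod_s0 : mod_s (fun=> 0 : R).
Proof. exact/slow_sub_mod/neg_sub_slow/neg_s0. Qed.

(** [bnd] wants one net chosen before q, while the left-hand side lets the range of e shrink with q.
    The supremum of |f e| over the ball reconciles them; it is 0 by convention when the ball is
    empty. *)
Lemma bnd_negP d (f : rnet d) :
  (forall M (q : nat), \forall e \near 0^'+,
     forall z, `|z| <= M -> `|f e z| <= e ^+ q) <->
  bnd (@neg_s R) f.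
Proof.
split=> [H M|nf M q]; last first.
  have [x xn fx] := nf M; apply: filterS2 fx (xn q) => e fx xq z /fx.
  by move=> /le_trans; apply; exact: le_trans (ler_norm _) xq.
pose S e := [set `|f e z| | z in [set z | `|z| <= M]].
have Sb e (q : nat) : 0 < e -> (forall z, `|z| <= M -> `|f e z| <= e ^+ q) ->
    ubound (S e) (e ^+ q).
  by move=> e0 fq _ [z /= zM <-]; exact: fq.
exists (fun e => sup (S e)).
  move=> q; apply: filterS2 (near0_le1 R) (H M q) => e /andP[e0 _] fq.
  have Sq := Sb _ _ e0 fq; rewrite ger0_norm.
    have [S0|/set0P/negP/negPn/eqP ->] := pselect (S e !=set0).
      exact: ge_sup.
    by rewrite sup0 exprn_ge0// ltW.
  have [[r Sr]|/set0P/negP/negPn/eqP ->] := pselect (S e !=set0); last by rewrite sup0.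
  have r0 : 0 <= r by case: Sr => z _ <-.
  rewrite (le_trans r0)//; apply: ub_le_sup => //.
  by exists (e ^+ q).
apply: filterS2 (near0_le1 R) (H M 0) => e /andP[e0 _] fq z zM.
apply: ub_le_sup; last by exists z.
by exists (e ^+ 0); exact: Sb.
Qed.

(** Leibniz's rule as an induction on the innermost derivative, without sums over multi-indices.
    Each factor only receives subsequences of s; recording this lets [dds_slow] count the
    derivatives in t. *)
Lemma bnd_dds_mul d X Y Z (s : seq 'I_d) (f g : rnet d) :
  additive_s Z -> (forall x y, X x -> Y y -> Z (fun e => x e * y e)) ->
  rsmooth_net f -> rsmooth_net g ->
  (forall r, subseq r s -> bnd X (fun e => dds r (f e))) ->
  (forall r, subseq r s -> bnd Y (fun e => dds r (g e))) ->
  bnd Z (fun e => dds s (fun z => f e z * g e z)).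
Proof.
move=> Zadd XYZ; elim/last_ind: s f g => [|s i IH] f g sf sg Xf Yg.
  by apply: (bndM XYZ); [exact: (Xf [::])|exact: (Yg [::])].
have sif : rsmooth_net (fun e => dd i (f e)) by move=> e /sf; exact: rsmooth_dd.
have sig : rsmooth_net (fun e => dd i (g e)) by move=> e /sg; exact: rsmooth_dd.
apply: (@bnd_eq _ _ (fun e z => dds s (fun z => dd i (f e) z * g e z) z +
                                dds s (fun z => f e z * dd i (g e) z) z)).
  move=> e e01 z; rewrite dds_rcons.
  have -> : dd i (fun z => f e z * g e z) =
      fun z => dd i (f e) z * g e z + f e z * dd i (g e) z.
    by apply/funext => y; rewrite ddM//; apply: rsmooth_differentiable; auto.
  by rewrite ddsD//; apply: rsmoothM; auto.
have sr r : subseq r s -> subseq r (rcons s i).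
  by move=> rs; apply: (subseq_trans rs); exact: subseq_rcons.
have srr r : subseq r s -> subseq (rcons r i) (rcons s i).
  by move=> rs; rewrite -!cats1 cat_subseq.
apply: bndD => //; apply: IH => // r rs; try by auto.
  by have := Xf _ (srr _ rs); under eq_fun do rewrite dds_rcons.
by have := Yg _ (srr _ rs); under eq_fun do rewrite dds_rcons.
Qed.

Lemma allbM d X Y Z (f g : rnet d) :
  additive_s Z -> (forall x y, X x -> Y y -> Z (fun e => x e * y e)) ->
  allb X f -> allb Y g -> allb Z (fun e z => f e z * g e z).
Proof.
move=> Zadd XYZ [sf Xf] [sg Yg]; split=> [e e01|s].
  by apply: rsmoothM; [exact: sf|exact: sg].
exact: (bnd_dds_mul Zadd XYZ).
Qed.

Lemma allbD d X (f g : rnet d) : additive_s X ->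
  allb X f -> allb X g -> allb X (fun e z => f e z + g e z).
Proof.
move=> Xadd [sf Xf] [sg Xg]; split=> [e e01|s].
  by apply: rsmoothD; [exact: sf|exact: sg].
apply: (@bnd_eq _ _ (fun e z => dds s (f e) z + dds s (g e) z)).
  by move=> e e01 z; rewrite ddsD//; auto.
exact: bndD.
Qed.

Lemma allbN d X (f : rnet d) : allb X f -> allb X (fun e z => - f e z).
Proof.
move=> [sf Xf]; split=> [e e01|s]; first by apply: rsmoothN; auto.
apply: (@bnd_eq _ _ (fun e z => - dds s (f e) z)); last exact: bndN.
by move=> e e01 z; rewrite ddsN//; auto.
Qed.

Lemma allbB d X (f g : rnet d) : additive_s X ->
  allb X f -> allb X g -> allb X (fun e z => f e z - g e z).
Proof. by move=> ? ? ?; apply: allbD => //; exact: allbN. Qed.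

Lemma allb_cst0 d X : X (fun=> 0) -> allb X (fun (_ : R) (_ : 'rV[R]_d) => 0).
Proof.
move=> X0; split=> [e _|s M]; first exact: rsmooth_cst.
by exists (fun=> 0) => //; apply: nearW => e z _; rewrite dds_cst0 normr0.
Qed.

Lemma allb_eq d X (f g : rnet d) :
  (forall e, 0 < e <= 1 -> f e =1 g e) -> allb X f -> allb X g.
Proof.
move=> fg [sf Xf].
have fg' e : 0 < e <= 1 -> f e = g e by move=> e01; apply/funext/fg.
split=> [e e01|s]; first by rewrite -fg'//; exact: sf.
by apply: (bnd_eq _ (Xf s)) => e e01 z; rewrite fg'.
Qed.

Lemma allb_sum d X (I : Type) (r : seq I) (f : I -> rnet d) :
  X (fun=> 0) -> additive_s X -> (forall i, allb X (f i)) ->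
  allb X (fun e z => \sum_(i <- r) f i e z).
Proof.
move=> X0 Xadd Xf; elim: r => [|i r IH].
  by apply: (allb_eq _ (allb_cst0 _ X0)) => e _ z; rewrite big_nil.
apply: (@allb_eq _ _ (fun e z => f i e z + \sum_(j <- r) f j e z)).
  by move=> e _ z; rewrite big_cons.
exact: allbD.
Qed.

Lemma allb_dds d X (s : seq 'I_d) (f : rnet d) :
  allb X f -> allb X (fun e => dds s (f e)).
Proof.
move=> [sf Xf]; split=> [e e01|r]; first by apply: rsmooth_dds; exact: sf.
by under eq_fun do rewrite -dds_cat; exact: Xf.
Qed.

Lemma allb_coord_map d p X (sg : 'I_d -> option 'I_p) l (C : R) (f : rnet p) :
  X (fun=> 0) -> coord_map sg l -> (forall z, `|l z| <= C + `|z|) ->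
  allb X f -> allb X (fun e z => f e (l z)).
Proof.
move=> X0 cl lC [sf Xf]; split=> [e e01|s].
  by apply: (rsmooth_coord_map cl); exact: sf.
have [[r re]|e0] := dds_coord_map s cl.
  move=> M; have [x Xx fx] := Xf r (C + M); exists x => //.
  apply: filterS fx => e fx z zM; rewrite re fx//.
  by rewrite (le_trans (lC z))// lerD2l.
by move=> M; exists (fun=> 0) => //; apply: nearW => e z _; rewrite e0 normr0.
Qed.

(* Landau's inequality: |f'| <= 2 sup |f| / h + h sup |f''|, where h is chosen
   as a power of e. *)
Lemma neg_dd d (i : 'I_d) (f : rnet d) : rsmooth_net f ->
  bnd (@mod_s R) (fun e => dd i (dd i (f e))) -> bnd (@neg_s R) f ->
  bnd (@neg_s R) (fun e => dd i (f e)).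
Proof.
move=> sf modf /bnd_negP negf; apply/bnd_negP => M q.
have [x [N xN] fx] := modf (M + 1).
apply: filterS3 (filterI (near0_le1 R) (near0_mul_le (3:R))) (filterI fx xN)
  (negf (M + 1) (N + q + 1 + q + 1)%N).
move=> e [/andP[e0 e1] e3] [{}fx {}xN] fq z zM.
(* On the ball |f| is at most h e^(q+1) and |f''| at most e^-N, so the quotient contributes 2
   e^(q+1) and the second-order term e^(q+1); the surplus factor 3 e is at most 1. *)
set h := e ^+ (N + q + 1).
have h0 : 0 < h by rewrite exprn_gt0.
have h1 : h <= 1 by rewrite exprn_ile1 // ltW.
have e01 : 0 < e <= 1 by rewrite e0.
have df : forall y, differentiable (f e) y by move=> y; exact/rsmooth_differentiable/sf.
have ddf : forall y, differentiable (dd i (f e)) y.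
  by move=> y; exact/rsmooth_differentiable/rsmooth_dd/sf.
have [th [thh e2]] := mvt_coord i z h df.
have [th' [thh' e4]] := mvt_coord i z th ddf.
have zle (c : R) : `|c| <= h -> `|z + c *: delta_mx 0 i| <= M + 1.
  move=> ch; rewrite (le_trans (ler_normD _ _))// lerD// normrZ.
  by rewrite -[leRHS]mulr1 ler_pM// ?(le_trans ch)// norm_delta_le.
rewrite (gtr0_norm h0) in thh.
have b1 := fq _ (zle h (eq_ind_r (fun t => t <= h) (lexx h) (gtr0_norm h0))).
have b0 := fq z (le_trans zM (ltW (ltr_pwDr ltr01 (lexx M)))).
have b2 := le_trans (fx _ (zle th' (le_trans thh' thh))) (le_trans (ler_norm _) xN).
have -> : dd i (f e) z = (f e (z + h *: delta_mx 0 i) - f e z) / h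
    - th * dd i (dd i (f e)) (z + th' *: delta_mx 0 i).
  by rewrite -e4 e2 mulrAC divff ?mul1r ?gt_eqF//; ring.
rewrite (le_trans (ler_normB _ _))// !normrM normfV (gtr0_norm h0).
have c1 : `|f e (z + h *: delta_mx 0 i) - f e z| / h <= 2 * (e * e ^+ q).
  rewrite ler_pdivrMr// (le_trans (ler_normB _ _))// (le_trans (lerD b1 b0))//.
  by rewrite /h !exprD expr1 le_eqVlt; apply/orP; left; apply/eqP; ring.
have c2 : `|th| * `|dd i (dd i (f e)) (z + th' *: delta_mx 0 i)| <= e * e ^+ q.
  rewrite (le_trans (ler_pM _ _ thh b2))// /h !exprD expr1.
  by rewrite mulrC !mulrA mulVf ?mul1r ?expf_neq0 ?gt_eqF// mulrC.
rewrite (le_trans (lerD c1 c2))//.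
have -> : 2 * (e * e ^+ q) + e * e ^+ q = 3 * e * e ^+ q by ring.
by rewrite -[leRHS]mul1r ler_wpM2r// exprn_ge0// ltW.
Qed.

Lemma allb_neg d (f : rnet d) :
  allb (@mod_s R) f -> bnd (@neg_s R) f -> allb (@neg_s R) f.
Proof.
move=> [sf modf] negf; split=> //; elim=> [|i s IH] //=.
apply: neg_dd => //; last exact: (modf [:: i, i & s]).
by move=> e e01; apply: rsmooth_dds; exact: sf.
Qed.

End Nets.

(** * Complex valued nets and their real and imaginary parts *)


Section Bridge.
Variable R : realType.

Definition rep d (u : net R d) : rnet R d := fun e z => complex.Re (u e z).
Definition imp d (u : net R d) : rnet R d := fun e z => complex.Im (u e z).

Lemma pdE d (s : seq 'I_d) (f : 'rV[R]_d -> R[i]) :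
  pd s f = fun x => dds s (fun y => complex.Re (f y)) x
                 +i* dds s (fun y => complex.Im (f y)) x.
Proof.
elim: s => [|i s IH] /=; first by apply/funext => x; case: (f x).
by rewrite IH.
Qed.

Lemma smooth_onT d (f : 'rV[R]_d -> R[i]) : smooth_on setT f <->
  rsmooth (fun y => complex.Re (f y)) /\ rsmooth (fun y => complex.Im (f y)).
Proof.
split=> [sf|[sr si] s x _]; last by rewrite pdE /=; split.
by split=> s x; have [] := sf s x I; rewrite pdE.
Qed.

Lemma smooth_netP d (u : net R d) :
  smooth_net u <-> rsmooth_net (rep u) /\ rsmooth_net (imp u).
Proof.
split=> [su|[sr si] e e01].
  by split=> e e01; have /smooth_onT[] := su _ e01.
by apply/smooth_onT; split; [exact: sr|exact: si].
Qed.

Lemma Re_le_cabs (z : R[i]) : `|complex.Re z| <= cabs z.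
Proof.
by case: z => a b; rewrite /cabs /= -sqrtr_sqr ler_wsqrtr// lerDl sqr_ge0.
Qed.

Lemma Im_le_cabs (z : R[i]) : `|complex.Im z| <= cabs z.
Proof.
by case: z => a b; rewrite /cabs /= -sqrtr_sqr ler_wsqrtr// lerDr sqr_ge0.
Qed.

Lemma cabs_le (z : R[i]) : cabs z <= `|complex.Re z| + `|complex.Im z|.
Proof.
case: z => a b; rewrite /cabs /= -[leRHS]ger0_norm ?addr_ge0//.
rewrite -sqrtr_sqr ler_wsqrtr// sqrrD !real_normK ?num_real//.
by rewrite lerD2r lerDl mulrn_wge0// mulr_ge0.
Qed.

Lemma cabs_real (c : R) : cabs c%:C = `|c|.
Proof. by rewrite /cabs /= expr0n/= addr0 sqrtr_sqr. Qed.

Lemma closed_norm_le d (M : R) : closed [set z : 'rV[R]_d | `|z| <= M].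
Proof.
have -> : [set z : 'rV[R]_d | `|z| <= M] = (@Num.norm _ _) @^-1` [set x | x <= M] by [].
apply: preimage_closed; last exact: closed_le.
by move=> z _; exact: norm_continuous.
Qed.

Lemma compact_ball d (M : R) : compact [set z : 'rV[R]_d | `|z| <= M].
Proof.
apply: bounded_closed_compact; last exact: closed_norm_le.
by exists M; split; [exact: num_real|move=> x /ltW Mx z /= /le_trans; apply].
Qed.

Lemma compact_sub_ball d (K : set 'rV[R]_d) : compact K ->
  exists M, K `<=` [set z | `|z| <= M].
Proof.
move=> /compact_bounded[M [_ KM]]; exists (M + 1) => z Kz.
by apply: KM Kz; rewrite ltrDl.
Qed.

Lemma supK_le d (K : set 'rV[R]_d) f (c : R) :
  (supK K f <= c%:E)%E <-> forall z, K z -> cabs (f z) <= c.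
Proof.
split=> [fc z Kz|fc]; last by apply: ge_ereal_sup => _ [z Kz <-]; rewrite lee_fin fc.
by rewrite -lee_fin; apply: le_trans fc; apply: ereal_sup_ubound; exists z.
Qed.

Lemma bigO_supK d (K : set 'rV[R]_d) (u : net R d) s (g : R -> R) :
  bigOeps (fun e => supK K (pd s (u e))) g ->
  exists2 C, 0 < C & \forall e \near 0^'+, forall z, K z ->
    `|dds s (rep u e) z| <= C * g e /\ `|dds s (imp u e) z| <= C * g e.
Proof.
move=> [C C0 uC]; exists C => //; apply: filterS uC => e /supK_le uC z Kz.
have := uC z Kz; rewrite pdE => uCz.
by split; apply: le_trans uCz;
  [exact: (Re_le_cabs (_ +i* _))|exact: (Im_le_cabs (_ +i* _))].
Qed.

Lemma bigO_supK_conv d (K : set 'rV[R]_d) (u : net R d) s (g x y : R -> R) :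
  (\forall e \near 0^'+, forall z, K z ->
    `|dds s (rep u e) z| <= x e /\ `|dds s (imp u e) z| <= y e) ->
  (\forall e \near 0^'+, x e + y e <= g e) ->
  bigOeps (fun e => supK K (pd s (u e))) g.
Proof.
move=> uxy xyg; exists 1 => //; apply: filterS2 uxy xyg => e uxy xyg.
apply/supK_le => z Kz; rewrite mul1r (le_trans _ xyg)// pdE.
by have [ux uy] := uxy z Kz; rewrite (le_trans (cabs_le _))// lerD.
Qed.

Lemma mod_pow (C : R) (N : nat) : mod_s (fun e : R => C * e ^- N).
Proof.
apply: modM; first exact/slow_sub_mod/slow_cst.
exists N; apply: filterS (near0_le1 R) => e /andP[e0 _].
by rewrite ger0_norm// invr_ge0 exprn_ge0// ltW.
Qed.

Lemma moderateP d (u : net R d) :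
  moderate u <-> allb (@mod_s R) (rep u) /\ allb (@mod_s R) (imp u).
Proof.
split=> [[/smooth_netP[sr si] mu]|[[sr mr] [si mi]]].
  have b s M := bigO_supK (projT2 (cid (mu _ (@compact_ball d M) s))).
  by split; split=> // s M; have [C C0 uC] := b s M;
    (eexists; [exact: mod_pow C (projT1 (cid (mu _ (@compact_ball d M) s)))|];
     apply: filterS uC => e uC z zM; have [] := uC z zM).
split; first exact/smooth_netP.
move=> K /compact_sub_ball[M KM] s.
have [[x xm rx] [y ym iy]] := (mr s M, mi s M).
have [N xyN] := modD xm ym.
exists N; apply: (@bigO_supK_conv _ _ _ _ _ x y).
  by apply: filterS2 rx iy => e rx iy z /KM zM; split; [exact: rx|exact: iy].
by apply: filterS xyN => e; apply: le_trans; exact: ler_norm.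
Qed.

Lemma negligible_netP d (u : net R d) :
  negligible_net u <-> allb (@neg_s R) (rep u) /\ allb (@neg_s R) (imp u).
Proof.
split=> [[/smooth_netP[sr si] nu]|[[sr nr] [si ni]]].
  have b s M (q : nat) : \forall e \near 0^'+, forall z : 'rV[R]_d, `|z| <= M ->
      `|dds s (rep u e) z| <= e ^+ q /\ `|dds s (imp u e) z| <= e ^+ q.
    have [C C0 uC] := bigO_supK (nu _ (@compact_ball d M) (fun _ _ => I) s q.+1).
    apply: filterS3 (near0_le1 R) (near0_mul_le C) uC => e /andP[e0 _] Ce uC z zM.
    have Cq : C * e ^+ q.+1 <= e ^+ q.
      by rewrite exprS mulrA -[leRHS]mul1r ler_wpM2r// exprn_ge0// ltW.
    by have [u1 u2] := uC z zM; split; apply: le_trans Cq.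
  by split; split=> // s; apply/bnd_negP => M q; apply: filterS (b s M q) => e H z zM;
    have [] := H z zM.
split; first exact/smooth_netP.
move=> K /compact_sub_ball[M KM] _ s q.
have [[x xm rx] [y ym iy]] := (nr s M, ni s M).
apply: (@bigO_supK_conv _ _ _ _ _ x y).
  by apply: filterS2 rx iy => e rx iy z /KM zM; split; [exact: rx|exact: iy].
by apply: filterS (negD xm ym q) => e; apply: le_trans; exact: ler_norm.
Qed.

Lemma slow_scaleP (mu : R -> R[i]) : slow_scale mu -> slow_s (fun e => cabs (mu e)).
Proof.
(* The exponent is doubled to absorb the constant C of the O: C e^-1 is at most e^-2 for small e,
   and the root of that is e^-1. *)
move=> mus N; have N0 : (0 : R) <= (N * 2)%:R by [].
have [C C0 muC] := mus _ N0.
apply: filterS3 (near0_le1 R) (near0_mul_le C) muC => e /andP[e0 _] Ce.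
have c0 : 0 <= cabs (mu e) by rewrite (le_trans _ (Re_le_cabs _)).
have ei : 0 < e^-1 by rewrite invr_gt0.
rewrite lee_fin powR_mulrn// (ger0_norm c0) exprM => le2.
rewrite -(ler_pXn2r (_ : 0 < 2)%N) ?nnegrE ?exprn_ge0// ?(ltW ei)//.
by rewrite (le_trans le2)// expr2 ler_wpM2r ?(ltW ei)// -div1r ler_pdivlMr.
Qed.

Lemma slow_scale_real (x : R -> R) : slow_s x -> slow_scale (fun e => (x e)%:C).
Proof.
move=> xs q q0; exists 1 => //.
pose N := Num.truncn q.
apply: filterS2 (near0_le1 R) (xs N.+1) => e /andP[e0 e1] xN.
rewrite lee_fin mul1r cabs_real.
have [x1|/ltW x1] := leP `|x e| 1.
  rewrite (@le_trans _ _ 1)// ?invf_ge1//.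
  by have := ge0_ler_powR q0 (normr_ge0 (x e)) ler01 x1; rewrite powR1.
apply: le_trans xN; rewrite -powR_mulrn// ler_powR//.
by rewrite ltW// truncnS_gt.
Qed.

Lemma bnd_slow_net d (u : net R d) s :
  (forall K, compact K -> exists2 mu, slow_scale mu &
      bigOeps (fun e => supK K (pd s (u e))) (fun e => cabs (mu e))) ->
  bnd (@slow_s R) (fun e => dds s (rep u e)).
Proof.
move=> H M; have [mu mus /bigO_supK[C C0 uC]] := H _ (@compact_ball d M).
exists (fun e => C * cabs (mu e)).
  exact: (slowM (slow_cst _) (slow_scaleP mus)).
by apply: filterS uC => e uC z zM; have [] := uC z zM.
Qed.

(** The exponential of n C log m is the power m^(n C), at most a natural power of the slow scale net
    m because m >= 1. The maximum with 1 keeps the logarithm nonnegative where |mu| is below 1. *)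
Lemma log_slow_ln (mu : R -> R[i]) (C : R) : slow_scale mu -> 0 < C ->
  log_s (fun e => C * ln (Num.max 1 (cabs (mu e)))).
Proof.
move=> mus C0 n.
pose m e : R := Num.max 1 (cabs (mu e)).
have ms : slow_s m.
  move=> N; apply: filterS3 (near0_le1 R) (slow_scaleP mus N) (slow_cst 1 N) => e _ muN.
  rewrite /m; have [_|] := leP 1 (cabs (mu e)) => //.
pose K := (Num.truncn (n%:R * C)).+1.
have mK : slow_s (fun e => m e ^+ K).
  by move=> N; apply: filterS (ms (K * N)%N) => e; rewrite normrX exprM.
apply: (slow_solid mK); apply: nearW => e; rewrite normr_expR.
have m1 : 1 <= m e by rewrite le_max lexx.
have m0 : 0 < m e by rewrite (lt_le_trans ltr01).
rewrite normrM (gtr0_norm C0) (ger0_norm (ln_ge0 m1)) normrX (gtr0_norm m0).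
rewrite -[in leRHS](lnK (_ : m e \is Num.pos)) ?posrE// -expRM_natl ler_expR.
by rewrite mulrA ler_wpM2r ?ln_ge0// ltW// truncnS_gt.
Qed.

Lemma bnd_slow_log_net d (u : net R d) :
  (forall K, compact K -> exists2 mu, slow_scale mu &
      bigOeps (fun e => supK K (u e)) (fun e => ln (cabs (mu e)))) ->
  bnd (@log_s R) (rep u).
Proof.
move=> H M; have [mu mus [C C0 uC]] := H _ (@compact_ball d M).
exists (fun e => C * ln (Num.max 1 (cabs (mu e)))); first exact: log_slow_ln.
apply: filterS uC => e /supK_le uC z /uC uz.
rewrite (le_trans (Re_le_cabs _))// (le_trans uz)// ler_wpM2l ?(ltW C0)//.
have [mu1|mu1] := leP 1 (cabs (mu e)) => //.
by rewrite ln1 ln_le0// ltW.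
Qed.

End Bridge.

(** * Symbols that are linear in the covariable *)


Section LinearSymbols.
Variables (R : realType) (d n : nat).

Definition rlin (f : 'I_n -> 'rV[R]_d -> R) : 'rV[R]_(d + n) -> R :=
  fun z => \sum_h f h (lsubmx z) * rsubmx z 0 h.

(** This is [phase_of] over a base of any dimension: the eikonal equation lives over R^(1+n), its
    initial condition over R^n. *)
Definition clin (u : 'I_n -> net R d) : net R (d + n) :=
  fun e z => \sum_h u h e (lsubmx z) * (rsubmx z 0 h)%:C.

Definition lsub_index (i : 'I_(d + n)) : option 'I_d :=
  if fintype.split i is inl k then Some k else None.

Lemma coord_map_lsubmx : coord_map lsub_index (@lsubmx R 1 d n).
Proof.
split=> [x|i h y]; first exact: differentiable_lsubmx.
rewrite linearP /= /lsub_index; congr (_ *: _ + _).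
case: splitP => k ik; apply/rowP => j; rewrite !mxE eqxx/=.
  by congr (_%:R); rewrite -!val_eqE/= ik.
by rewrite -val_eqE/= ik (ltn_eqF (ltn_addr _ (ltn_ord j))).
Qed.

Lemma lsub_index_lshift k : lsub_index (lshift n k) = Some k.
Proof. by rewrite /lsub_index (unsplitK (inl k)). Qed.

Lemma lsub_index_rshift k : lsub_index (rshift d k) = None.
Proof. by rewrite /lsub_index (unsplitK (inr k)). Qed.

Lemma rsmooth_lsubmx (f : 'rV[R]_d -> R) : rsmooth f ->
  rsmooth (fun z : 'rV[R]_(d + n) => f (lsubmx z)).
Proof. exact: rsmooth_coord_map coord_map_lsubmx. Qed.

Lemma rsubmx_coord (h : 'I_n) :
  (fun z : 'rV[R]_(d + n) => rsubmx z 0 h) = (fun z => z 0 (rshift d h)).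
Proof. by apply/funext => z; rewrite mxE. Qed.

Lemma rsmooth_rsubmx (h : 'I_n) : rsmooth (fun z : 'rV[R]_(d + n) => rsubmx z 0 h).
Proof. by rewrite rsubmx_coord; exact: rsmooth_coord. Qed.

Lemma rsmooth_rlin f : (forall h, rsmooth (f h)) -> rsmooth (rlin f).
Proof.
move=> sf; apply: rsmooth_sum => h; apply: rsmoothM.
  exact: rsmooth_lsubmx.
exact: rsmooth_rsubmx.
Qed.

Lemma dd_rlin f j z : (forall h, rsmooth (f h)) ->
  dd j (rlin f) z = \sum_h
    ((if lsub_index j is Some k then dd k (f h) (lsubmx z) else 0) * rsubmx z 0 h
     + f h (lsubmx z) * (rshift d h == j)%:R).
Proof.
move=> sf.
have sl h := rsmooth_lsubmx (sf h).
have := @dds_sum R _ (index_enum 'I_n) xpredT _ [:: j]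
  (fun h (z : 'rV[R]_(d + n)) => f h (lsubmx z) * rsubmx z 0 h)
  (fun h => rsmoothM (sl h) (rsmooth_rsubmx h)).
move=> /(congr1 (fun F => F z)) /= ->; apply: eq_bigr => h _.
rewrite ddM; [|exact/rsmooth_differentiable|
  exact/rsmooth_differentiable/rsmooth_rsubmx].
by rewrite (dd_coord_map _ _ coord_map_lsubmx) rsubmx_coord dd_coord.
Qed.

Lemma dd_rlin_lshift f k : (forall h, rsmooth (f h)) ->
  dd (lshift n k) (rlin f) = rlin (fun h => dd k (f h)).
Proof.
move=> sf; apply/funext => z; rewrite dd_rlin// lsub_index_lshift.
apply: eq_bigr => h _; rewrite eq_sym (_ : (_ == _) = false) ?mulr0 ?addr0//.
by apply/negbTE; rewrite eq_lrshift.
Qed.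

Lemma dd_rlin_rshift f k : (forall h, rsmooth (f h)) ->
  dd (rshift d k) (rlin f) = fun z => f k (lsubmx z).
Proof.
move=> sf; apply/funext => z; rewrite dd_rlin// lsub_index_rshift.
rewrite (bigD1 k)//= big1 ?addr0 => [|h hk].
  by rewrite mul0r add0r eqxx mulr1.
by rewrite mul0r add0r (inj_eq (@rshift_inj _ _)) (negPf hk) mulr0.
Qed.

Lemma dds_rlin_lshift f be : (forall h, rsmooth (f h)) ->
  dds (map (@lshift d n) be) (rlin f) = rlin (fun h => dds be (f h)).
Proof.
move=> sf; elim: be => //= k be ->.
by rewrite dd_rlin_lshift// => h; exact: rsmooth_dds.
Qed.

Lemma dds_rlin_rshift2 f k al : (forall h, rsmooth (f h)) ->
  dds (map (@rshift d n) (rcons al k)) (rlin f) =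
  if al is [::] then (fun z => f k (lsubmx z)) else fun=> 0.
Proof.
move=> sf; rewrite map_rcons dds_rcons dd_rlin_rshift//.
case/lastP: al => [|al l] //=; rewrite map_rcons dds_rcons.
rewrite (dd_coord_map _ _ coord_map_lsubmx) lsub_index_rshift dds_cst0.
by case: al.
Qed.

Lemma enorm_ge0 (x : 'rV[R]_n) : 0 <= enorm x.
Proof. exact: sqrtr_ge0. Qed.

Lemma sqr_enorm (x : 'rV[R]_n) : enorm x ^+ 2 = \sum_i x 0 i ^+ 2.
Proof. by rewrite sqr_sqrtr// sumr_ge0// => i _; exact: sqr_ge0. Qed.

Lemma coord_le_enorm (x : 'rV[R]_n) i : `|x 0 i| <= enorm x.
Proof.
rewrite -sqrtr_sqr ler_wsqrtr// (bigD1 i)//= lerDl sumr_ge0// => j _.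
exact: sqr_ge0.
Qed.

Lemma enorm_gt0 (x : 'rV[R]_n) : x != 0 -> 0 < enorm x.
Proof.
move=> x0; rewrite lt_neqAle enorm_ge0 andbT eq_sym; apply: contra x0 => /eqP ex.
apply/eqP/rowP => i; rewrite mxE; apply/eqP; rewrite -normr_le0 -ex.
exact: coord_le_enorm.
Qed.

(** Three cases by linearity in xi. Without xi-derivatives the weight |xi|^-1 compensates |xi_h| <=
    |xi|; one xi-derivative leaves a single coefficient with weight 1; two or more give 0. *)
Lemma rlin_le f (b : 'I_n -> R) al be x xi : (forall h, rsmooth (f h)) ->
  xi != 0 -> (forall h, `|dds be (f h) x| <= b h) ->
  (enorm xi)^-1 * enorm xi ^+ size al *
    `|dds (map (@rshift d n) al ++ map (@lshift d n) be) (rlin f) (row_mx x xi)|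
  <= \sum_h b h.
Proof.
move=> sf xi0 fb; have e0 := enorm_gt0 xi0.
have b0 h : 0 <= b h by rewrite (le_trans _ (fb h)).
rewrite dds_cat dds_rlin_lshift//.
have sdf h : rsmooth (dds be (f h)) by exact: rsmooth_dds.
case/lastP: al => [|al k]; last first.
  rewrite dds_rlin_rshift2//; case: al => [|l al]; last first.
    by rewrite normr0 mulr0 sumr_ge0.
  rewrite /= expr1 mulVf ?gt_eqF// mul1r row_mxKl (le_trans (fb k))//.
  by rewrite (bigD1 k)//= lerDl sumr_ge0.
rewrite /= expr0 mulr1 mulrC ler_pdivrMr// /rlin row_mxKl row_mxKr.
rewrite (le_trans (ler_norm_sum _ _ _))// mulr_suml ler_sum// => h _.
by rewrite normrM ler_pM// coord_le_enorm.
Qed.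

Lemma Re_clin u e : (fun z => complex.Re (clin u e z)) = rlin (fun h => rep (u h) e).
Proof.
apply/funext => z; rewrite raddf_sum; apply: eq_bigr => h _; rewrite /rep.
by case: (u h e _) => a b /=; rewrite mulr0 subr0.
Qed.

Lemma Im_clin u e : (fun z => complex.Im (clin u e z)) = rlin (fun h => imp (u h) e).
Proof.
apply/funext => z; rewrite raddf_sum; apply: eq_bigr => h _; rewrite /imp.
by case: (u h e _) => a b /=; rewrite mulr0 add0r.
Qed.

Lemma smooth_clin u e : (forall h, rsmooth (rep (u h) e)) ->
  (forall h, rsmooth (imp (u h) e)) -> smooth_on setT (clin u e).
Proof.
move=> sr si; apply/smooth_onT; rewrite Re_clin Im_clin.
by split; exact: rsmooth_rlin.
Qed.

Lemma S1hg_clin u : (forall h, smooth_net (u h)) -> S1hg_net (clin u).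
Proof.
move=> su e e01; split=> [s x _|x xi l _ _].
  apply: smooth_clin => // h; have /smooth_netP[sr si] := su h.
    exact: sr.
  exact: si.
rewrite /clin !row_mxKl !row_mxKr mulr_sumr; apply: eq_bigr => h _.
by rewrite mxE rmorphM/= mulrCA.
Qed.

Lemma seminorm_clin_le u e (K : set 'rV[R]_d) al be (b c : 'I_n -> R) :
  (forall h, rsmooth (rep (u h) e)) -> (forall h, rsmooth (imp (u h) e)) ->
  (forall h z, K z -> `|dds be (rep (u h) e) z| <= b h) ->
  (forall h z, K z -> `|dds be (imp (u h) e) z| <= c h) ->
  (seminorm K al be (clin u e) <= (\sum_h b h + \sum_h c h)%:E)%E.
Proof.
move=> sr si rb ic; apply: ge_ereal_sup => _ [x [xi [Kx xi0 ->]]].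
rewrite lee_fin pdE Re_clin Im_clin.
apply: (@le_trans _ _ ((enorm xi)^-1 * enorm xi ^+ size al *
  (`|dds (map (@rshift d n) al ++ map (@lshift d n) be)
       (rlin (fun h => rep (u h) e)) (row_mx x xi)| +
   `|dds (map (@rshift d n) al ++ map (@lshift d n) be)
       (rlin (fun h => imp (u h) e)) (row_mx x xi)|))).
  apply: ler_wpM2l (cabs_le (_ +i* _)).
  by rewrite mulr_ge0 ?invr_ge0 ?exprn_ge0 ?enorm_ge0.
rewrite mulrDr lerD// rlin_le// => h; [exact: rb|exact: ic].
Qed.

Lemma seminorm_clin_bnd X u : X (fun=> 0) -> additive_s X ->
  (forall h, allb X (rep (u h)) /\ allb X (imp (u h))) ->
  forall K, compact K -> forall al be, exists2 x, X x &
    \forall e \near 0^'+, (seminorm K al be (clin u e) <= (x e)%:E)%E.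
Proof.
move=> X0 Xadd Xu K /compact_sub_ball[M KM] al be.
have Xs (y : 'I_n -> R -> R) : (forall h, X (y h)) -> X (fun e => \sum_h y h e).
  move=> Xy; elim: (index_enum _) => [|h r IH].
    by under eq_fun do rewrite big_nil.
  by under eq_fun do rewrite big_cons; exact: Xadd.
have /choice[b Hb] h : exists x, X x /\ \forall e \near 0^'+,
    forall z, `|z| <= M -> `|dds be (rep (u h) e) z| <= x e.
  by have [[_ /(_ be M)[x Xx bx]] _] := Xu h; exists x.
have /choice[c Hc] h : exists x, X x /\ \forall e \near 0^'+,
    forall z, `|z| <= M -> `|dds be (imp (u h) e) z| <= x e.
  by have [_ [_ /(_ be M)[x Xx bx]]] := Xu h; exists x.
exists (fun e => \sum_h b h e + \sum_h c h e).
  by apply: Xadd; apply: Xs => h; [case: (Hb h)|case: (Hc h)].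
have nb : \forall e \near 0^'+, forall h z,
    `|z| <= M -> `|dds be (rep (u h) e) z| <= b h e.
  by apply: filter_forall => h; case: (Hb h).
have nc : \forall e \near 0^'+, forall h z,
    `|z| <= M -> `|dds be (imp (u h) e) z| <= c h e.
  by apply: filter_forall => h; case: (Hc h).
apply: filterS3 (near0_le1 R) nb nc => e e01 {}nb {}nc.
apply: seminorm_clin_le => h; try by move=> z /KM; auto.
  by have [[+ _] _] := Xu h; exact.
by have [_ [+ _]] := Xu h; exact.
Qed.

Lemma sym_moderate_clin u : (forall h, moderate (u h)) -> sym_moderate (clin u).
Proof.
move=> mu; have mu' h := (moderateP (u h)).1 (mu h).
split; first by apply: S1hg_clin => h; exact: (mu h).1.
move=> K cK al be.
have [x [N xN] ux] := seminorm_clin_bnd (mod_s0 R) (@modD R) mu' cK al be.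
exists N, 1 => //; apply: filterS2 ux xN => e ux xN; apply: le_trans ux _.
by rewrite mul1r lee_fin (le_trans (ler_norm _)).
Qed.

Lemma sym_negligible_clin u :
  (forall h, negligible_net (u h)) -> sym_negligible (clin u).
Proof.
move=> mu; have mu' h := (negligible_netP (u h)).1 (mu h).
split; first by apply: S1hg_clin => h; exact: (mu h).1.
move=> K cK al be q.
have [x xN ux] := seminorm_clin_bnd (neg_s0 R) (@negD R) mu' cK al be.
exists 1 => //; apply: filterS2 ux (xN q) => e ux {}xN; apply: le_trans ux _.
by rewrite mul1r lee_fin (le_trans (ler_norm _)).
Qed.

Lemma sym_slow_scale_clin u :
  (forall h, allb (@slow_s R) (rep (u h)) /\ allb (@slow_s R) (imp (u h))) ->
  sym_slow_scale (clin u).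
Proof.
move=> mu K cK al be.
have [x xs ux] := seminorm_clin_bnd (neg_sub_slow (neg_s0 R)) (@slowD R) mu cK al be.
exists (fun e => (x e)%:C); first exact: slow_scale_real.
exists 1 => //; apply: filterS ux => e ux; apply: le_trans ux _.
by rewrite mul1r cabs_real lee_fin ler_norm.
Qed.

Lemma sym_negligible_eq (f g : net R (d + n)) :
  (forall e, 0 < e <= 1 -> f e =1 g e) -> sym_negligible f -> sym_negligible g.
Proof.
move=> fg [Sf nf].
have fg' e : 0 < e <= 1 -> f e = g e by move=> e01; apply/funext/fg.
split=> [e e01|K cK al be q]; first by rewrite -fg'//; exact: Sf.
have [C C0 H] := nf K cK al be q; exists C => //.
by apply: filterS2 (near0_le1 R) H => e e01; rewrite fg'.
Qed.

Lemma pd1_clin_lshift u e k z : (forall h, smooth_on setT (u h e)) ->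
  pd1 (lshift n k) (clin u e) z = clin (fun h => dnet k (u h)) e z.
Proof.
move=> su; rewrite /pd1 Re_clin Im_clin.
have sr h : rsmooth (rep (u h) e) by have /smooth_onT[] := su h.
have si h : rsmooth (imp (u h) e) by have /smooth_onT[] := su h.
rewrite -[X in X +i* _]/(dd _ _ z) -[X in _ +i* X]/(dd _ _ z).
rewrite !dd_rlin_lshift//.
set U := fun h => dnet k (u h).
transitivity (complex.Re (clin U e z) +i* complex.Im (clin U e z)); last by case: clin.
by rewrite -[complex.Re _]/((fun z => complex.Re (clin U e z)) z) Re_clin
  -[complex.Im _]/((fun z => complex.Im (clin U e z)) z) Im_clin.
Qed.

End LinearSymbols.

(** * Phase functions linear in the covariable *)


Section PhaseNets.
Variables (R : realType) (n : nat).

Lemma derive_slope d (f : 'rV[R]_d -> R) v x (c : R) :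
  (forall h : R, f (h *: v + x) - f x = h * c) -> 'D_v f x = c.
Proof.
move=> fc; rewrite /derive; apply: cvg_lim => //; apply: cvg_near_cst.
near=> h; rewrite /= fc /GRing.scale/= mulrA mulVf ?mul1r//.
by near: h; exact: nbhs_dnbhs_neq.
Unshelve. all: by end_near. Qed.

(* The derivatives of [phi(t, x, eta) - y eta] in y alone give |eta|^2 in the
   squared norm of the gradient, whatever phi is. *)
Lemma pd1_phase' (phi : 'rV[R]_((1 + n) + n) -> R[i]) z k w :
  pd1 (lshift n k) (phase' phi z) w = (- rsubmx w 0 k)%:C.
Proof.
have rE (h : R) : rsubmx (h *: delta_mx 0 (lshift n k) + w) = rsubmx w.
  apply/rowP => j; rewrite !mxE eqxx/= (_ : (_ == _) = false) ?mulr0 ?add0r//.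
  by apply/negbTE; rewrite eq_rlshift.
have dE (h : R) : dotp (lsubmx (h *: delta_mx 0 (lshift n k) + w)) (rsubmx w)
    = h * rsubmx w 0 k + dotp (lsubmx w) (rsubmx w).
  rewrite /dotp (bigD1 k)//= [in RHS](bigD1 k)//= addrA; congr (_ + _).
    by rewrite !mxE !eqxx/= mulr1 mulrDl.
  apply: eq_bigr => j jk; rewrite !mxE eqxx/= (inj_eq (@lshift_inj _ _)).
  by rewrite (negPf jk) mulr0 add0r.
rewrite /pd1; congr (_ +i* _); apply: derive_slope => h; rewrite /phase' rE dE.
  by case: (phi _) => a b /=; ring.
by case: (phi _) => a b /=; ring.
Qed.

Lemma grad_phase_ge (phi : 'rV[R]_((1 + n) + n) -> R[i]) z y eta :
  enorm eta ^+ 2 <= \sum_i cabs (grad (phase' phi z) (row_mx y eta) 0 i) ^+ 2.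
Proof.
rewrite big_split_ord/= sqr_enorm.
rewrite -[leLHS]addr0 lerD// ?sumr_ge0// => [|i _]; last exact: sqr_ge0.
apply: ler_sum => i _; rewrite mxE pd1_phase' row_mxKr cabs_real.
by rewrite normrN real_normK// num_real.
Qed.

Lemma grad_phase_neq0 (phi : 'rV[R]_((1 + n) + n) -> R[i]) z y eta :
  eta != 0 -> grad (phase' phi z) (row_mx y eta) != 0.
Proof.
move=> /enorm_gt0 e0; apply/eqP => g0.
have := grad_phase_ge phi z y eta; rewrite g0 big1 ?leNgt ?exprn_gt0// => i _.
by rewrite mxE -[0]/(0%:C) cabs_real normr0 expr0n.
Qed.

Lemma grad_inf_ge1 (phi : 'rV[R]_((1 + n) + n) -> R[i]) K' K :
  (1%:E <= grad_inf phi K' K)%E.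
Proof.
apply: le_ereal_inf_tmp => _ [z [y [eta [_ _ eta0 ->]]]]; rewrite lee_fin.
have e0 := enorm_gt0 eta0.
apply: le_trans (grad_phase_ge _ _ _ _).
rewrite sqr_enorm; under eq_bigr do rewrite mxE exprMn.
by rewrite -mulr_sumr -sqr_enorm -exprMn mulVf ?expr1n// gt_eqF.
Qed.

Lemma phase_net_phase_of (v : 'I_n -> net R (1 + n)) :
  (forall h, moderate (v h)) -> (forall h, real_net (v h)) ->
  phase_net (phase_of v).
Proof.
move=> mv rv; split.
- exact: (sym_moderate_clin mv).
- move=> e x xi e01 _.
  rewrite -[LHS]/((fun z => complex.Im (clin v e z)) _) Im_clin /rlin.
  by apply: big1 => h _; rewrite /imp rv// mul0r.
- by move=> e z y eta _; exact: grad_phase_neq0.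
- move=> K' K _ _; exists 1 => //.
  apply: filterS (near0_le1 R) => e /andP[e0 e1].
  by apply: le_trans (grad_inf_ge1 _ _ _); rewrite lee_fin powRr1// ltW.
Qed.

Lemma sym_eq_phase_of (u v : 'I_n -> net R (1 + n)) :
  (forall h, u h =G v h) -> sym_eq (phase_of u) (phase_of v).
Proof.
move=> uv; apply: sym_negligible_eq (sym_negligible_clin uv) => e e01 z.
by rewrite /clin /phase_of -sumrB; apply: eq_bigr => h _; rewrite mulrBl.
Qed.

Lemma eikonal_phase_of (a w : 'I_n -> net R (1 + n)) :
  (forall h, moderate (w h)) -> (forall h, transport_solution a h (w h)) ->
  eikonal_solution a (phase_of w).
Proof.
move=> mw tw; split.
  apply: sym_negligible_eq (sym_negligible_clin (fun h => (tw h).1)) => e e01 z.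
  have sw h : smooth_on setT (w h e) by exact: (mw h).1.
  have -> : dnet (lshift n (i_t n)) (phase_of w) e z =
      clin (fun h => dnet (i_t n) (w h)) e z by exact: pd1_clin_lshift.
  have dx j : dnet (lshift n (i_x j)) (phase_of w) e z =
      clin (fun h => dnet (i_x j) (w h)) e z by exact: pd1_clin_lshift.
  under [in RHS]eq_bigr do rewrite dx /clin mulr_sumr.
  rewrite exchange_big/= /clin -sumrB; apply: eq_bigr => h _.
  by rewrite mulrBl mulr_suml; congr (_ - _); apply: eq_bigr => j _; rewrite mulrA.
apply: sym_negligible_eq (sym_negligible_clin (fun h => (tw h).2)) => e e01 z.
rewrite /clin /phase_of !row_mxKl !row_mxKr /dotp rmorph_sum/= -sumrB.
by apply: eq_bigr => h _; rewrite mulrBl rmorphM.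
Qed.

End PhaseNets.

(** * Differential inequalities in one variable *)


Section OneVariable.
Variable R : realType.

Lemma mean_value_le (f df : R -> R) (T B a b : R) :
  (forall s, is_derive s (1 : R) f (df s)) ->
  (forall s, `|s| <= T -> `|df s| <= B) ->
  `|a| <= T -> `|b| <= T -> `|f b - f a| <= B * `|b - a|.
Proof.
move=> fd fB; rewrite (ler_norml a) (ler_norml b) => /andP[a1 a2] /andP[b1 b2].
have [c [c1 c2 ->]] := mvt_line a b fd.
rewrite normrM ler_wpM2r// fB// ler_norml (le_trans _ c1)/= ?(le_trans c2)//.
  by rewrite ge_max a2.
by rewrite le_min a1.
Qed.

(** Both directions of time are treated at once: the integrating factor carries the sign of t, and
    [(f s + sig) * expR (- (sg * lam) * s)] does not exceed its value at 0 when t is reached,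
    whether t is positive or negative. *)
Lemma gronwall (f df : R -> R) (lam sig t : R) :
  (forall s, is_derive s (1 : R) f (df s)) ->
  (forall s, `|s| <= `|t| -> `|df s| <= lam * (f s + sig)) ->
  f t + sig <= (f 0 + sig) * expR (lam * `|t|).
Proof.
move=> fd dfle; pose sg : R := Num.sg t.
have tE : t = sg * `|t| by rewrite -numEsg.
pose g s := (f s + sig) * expR (- (sg * lam) * s).
pose dg s := (df s - sg * lam * (f s + sig)) * expR (- (sg * lam) * s).
have gd s : is_derive s (1 : R) g (dg s).
  have fds := fd s.
  apply: is_derive_eq; rewrite /dg /GRing.scale/=; ring.
have [c [c1 c2]] := mvt_line 0 t gd; rewrite subr0 => e.
have cT : `|c| <= `|t|.
  move: c1 c2; have [t0|t0] := leP 0 t => c1 c2.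
    by rewrite !ger0_norm.
  by rewrite !ler0_norm ?lerN2// ltW.
have gle : g t <= g 0.
  rewrite -subr_le0 e [X in _ * X]tE mulrA mulr_le0_ge0//.
  rewrite /dg mulrAC mulr_le0_ge0 ?expR_ge0//.
  have := dfle c cT; set B := lam * _ => dB.
  have -> : (df c - sg * lam * (f c + sig)) * sg = df c * sg - sg * sg * B.
    by rewrite /B; ring.
  rewrite /sg; have [t0|t0|t0] := sgrP t; first by rewrite !mulr0 mul0r subrr.
    by rewrite !mulr1 mul1r subr_le0 (le_trans (ler_norm _)).
  by rewrite mulrNN mulr1 mulrN1 mul1r subr_le0 (le_trans _ dB)// -normrN ler_norm.
move: gle; rewrite /g mulr0 expR0 mulr1 => gle.
have -> : lam * `|t| = sg * lam * t.
  by rewrite {2}tE /sg; have [t0|t0|t0] := sgrP t; rewrite ?t0 ?normr0; ring.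
rewrite -ler_pdivrMr ?expR_gt0//; apply: le_trans gle.
by rewrite -expRN mulNr.
Qed.

(** A quadratic remainder bound settles the derivative of the squared positive part at its kink and
    elsewhere by the same inequality. *)
Lemma is_derive_quadratic (f : R -> R) (x d : R) :
  (forall h, `|f (x + h) - f x - h * d| <= h ^+ 2) -> is_derive x (1 : R) f d.
Proof.
move=> fq.
have fc : (fun h => h^-1 *: (f (h *: (1 : R) + x) - f x)) @ 0^' --> d.
  apply/cvgrPdist_le => /= e e0; near=> h.
  have h0 : h != 0 by near: h; exact: nbhs_dnbhs_neq.
  have he : `|h| <= e by near: h; exact: dnbhs0_le.
  have := fq h; rewrite /GRing.scale/= mulr1 [x + h]addrC => fh.
  have -> : d - h^-1 * (f (h + x) - f x) = - (h^-1 * (f (h + x) - f x - h * d)).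
    by field.
  rewrite normrN normrM normfV ler_pdivrMl ?normr_gt0// (le_trans fh)//.
  by rewrite -[h ^+ 2]ger0_norm ?sqr_ge0// normrX expr2 ler_wpM2l.
by apply: DeriveDef; [apply/cvg_ex; exists d|exact/cvg_lim].
Unshelve. all: by end_near. Qed.

Definition sqpos (u : R) : R := Num.max 0 u ^+ 2.

Lemma is_derive_sqpos (u : R) : is_derive u (1 : R) sqpos (2 * Num.max 0 u).
Proof.
apply: is_derive_quadratic => h; rewrite /sqpos ler_norml.
have [u0|u0] := leP u 0; have [v0|v0] := leP (u + h) 0;
  rewrite ?expr0n/=; apply/andP; split; nra.
Qed.

(** A differentiable step from 0 to 1: squaring the positive part flattens the lower end at 0, and
    doing so again to [1 - sqpos u] flattens the upper end at 1. Its slope in between is at most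
    4. *)
Definition step (u : R) : R := 1 - sqpos (1 - sqpos u).

Lemma step_le0 u : u <= 0 -> step u = 0.
Proof.
by move=> u0; rewrite /step /sqpos (max_l u0) expr0n/= subr0 max_r// expr1n subrr.
Qed.

Lemma step_ge1 u : 1 <= u -> step u = 1.
Proof.
move=> u1; have u0 : 0 <= u by rewrite (le_trans ler01).
by rewrite /step /sqpos (max_r u0) max_l ?expr0n/= ?subr0// subr_le0 expr_ge1.
Qed.

Lemma is_derive_step (f : R -> R) df s : is_derive s (1 : R) f df ->
  is_derive s (1 : R) (fun r => step (f r))
    (4 * Num.max 0 (1 - sqpos (f s)) * Num.max 0 (f s) * df).
Proof.
move=> fd.
have d1 := is_derive1_comp (is_derive_sqpos (f s)) fd.
have d2 : is_derive s (1 : R) (fun r => 1 - sqpos (f r)) (- (2 * Num.max 0 (f s) * df)).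
  have := is_deriveB (is_derive_cst (1 : R) s 1) d1.
  by move=> /is_derive_eq; apply; rewrite sub0r.
have d3 := @is_derive1_comp _ _ (fun r => 1 - sqpos (f r)) _ _ _
  (is_derive_sqpos (1 - sqpos (f s))) d2.
have : is_derive s (1 : R) (fun r => 1 - sqpos (1 - sqpos (f r)))
   (0 - 2 * Num.max 0 (1 - sqpos (f s)) * (- (2 * Num.max 0 (f s) * df))).
  exact: is_deriveB.
move=> H; apply: (is_derive_eq H); ring.
Qed.

(* A quantity that is nearly stationary while in ]P, P + 1[ cannot cross that
   interval: compose it with [step]. *)
Lemma barrier (f df : R -> R) (T P B a b : R) :
  (forall s, is_derive s (1 : R) f (df s)) ->
  (forall s, `|s| <= T -> P < f s < P + 1 -> `|df s| <= B) ->
  0 <= B -> 8 * T * B < 1 -> `|a| <= T -> `|b| <= T -> f a <= P -> f b < P + 1.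
Proof.
move=> fd fB B0 TB aT bT fa.
have gd s : is_derive s (1 : R) (fun r => f r - P) (df s).
  have := fd s => ?; apply: is_derive_eq; exact: subr0.
have H := mean_value_le (fun s => is_derive_step (gd s))
  (_ : forall s, `|s| <= T -> _ <= 4 * B) aT bT.
have {}H : `|step (f b - P) - step (f a - P)| <= 4 * B * `|b - a|.
  apply: H => s sT; set g := f s - P; rewrite normrM !normrM normr_nat.
  have [g0|g0] := leP g 0; first by rewrite normr0 mulr0 mul0r mulr_ge0.
  have [g1|g1] := leP 1 g.
    rewrite [Num.max 0 (1 - _)]max_l ?normr0 ?mulr0 ?mul0r ?mulr_ge0//.
    by rewrite subr_le0 /sqpos max_r ?expr_ge1// ltW.
  have dB : `|df s| <= B.
    by apply: fB => //; rewrite /g in g0 g1; apply/andP; split; lra.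
  rewrite (gtr0_norm g0) -!mulrA ler_pM2l// -[leRHS]mul1r mulrA ler_pM ?mulr_ge0//.
    by rewrite ltW.
  rewrite -[leRHS]mul1r ler_pM ?(ltW g0) ?(ltW g1)//.
  rewrite ger0_norm ?le_max ?lexx// ge_max ler01/= /sqpos lerBlDr lerDl.
  exact: sqr_ge0.
(* Otherwise [step] would rise from 0 to 1 at a rate of at most 4 B over a parameter length of at
   most 2 T, against 8 T B < 1. *)
rewrite ltNge; apply/negP => fb.
move: H; rewrite [step (f a - P)]step_le0 ?subr_le0// step_ge1; last by lra.
rewrite subr0 normr1 leNgt => /negP; apply.
rewrite (le_lt_trans _ TB)// -[8]/(4 * 2)%:R natrM -!mulrA ler_pM2l//.
have -> : 2 * (T * B) = B * (T + T) by ring.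
by rewrite ler_wpM2l// (le_trans (ler_normB _ _))// lerD.
Qed.

End OneVariable.

(** * Characteristic curves *)


Section Characteristics.
Variables (R : realType) (n : nat).

Definition pt (s : R) (x : 'rV[R]_n) : 'rV[R]_(1 + n) := row_mx (const_mx s) x.

Definition cpt (x : 'rV[R]_n) (t s : R) : 'rV[R]_(n + (1 + 1)) :=
  row_mx x (row_mx (const_mx t) (const_mx s)).

Definition cv (C : 'I_n -> rnet R (n + (1 + 1))) (e : R) z : 'rV[R]_n :=
  \row_j C j e z.

(** The characteristic system up to negligible errors, required for values only. In this form it
    survives a change of representatives of the coefficients, see [char_netE]. The last field is the
    compact support in x: on bounded sets the coefficients are negligible where |x|^2 >= P. *)
Record char_net (A : 'I_n -> rnet R (1 + n))
    (C : 'I_n -> rnet R (n + (1 + 1))) : Prop := CharNet {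
  char_smooth : forall h, rsmooth_net (C h);
  char_ode : forall h, bnd (@neg_s R) (fun e z =>
    dd (i_s n) (C h e) z + A h e (row_mx (rsubmx (rsubmx z)) (cv C e z)));
  char_init : forall h, bnd (@neg_s R) (fun e (z : 'rV[R]_(1 + n)) =>
    C h e (row_mx (rsubmx z) (row_mx (lsubmx z) (lsubmx z))) - rsubmx z 0 h);
  char_supp : exists P, forall h M (q : nat), \forall e \near 0^'+,
    forall z : 'rV[R]_(1 + n), `|z| <= M ->
      P <= \sum_i (rsubmx z 0 i) ^+ 2 -> `|A h e z| <= e ^+ q }.

Lemma sumr_le_const (F : 'I_n -> R) (c : R) :
  (forall h, F h <= c) -> \sum_h F h <= n%:R * c.
Proof.
move=> Fc; have -> : n%:R * c = \sum_(h < n) c.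
  by rewrite sumr_const card_ord mulr_natl.
exact: ler_sum.
Qed.

Lemma row_mx_coord p q (a : 'rV[R]_p) (b : 'rV[R]_q) i :
  row_mx a b 0 i = match fintype.split i with inl k => a 0 k | inr k => b 0 k end.
Proof. by rewrite mxE. Qed.

Lemma norm_row_mx_le p q (a : 'rV[R]_p) (b : 'rV[R]_q) M :
  `|a| <= M -> `|b| <= M -> `|row_mx a b| <= M.
Proof.
move=> aM bM; apply: norm_row_le => [|i]; first exact: le_trans aM.
rewrite row_mx_coord; case: fintype.split => k.
  exact: le_trans (norm_coord_le _ _) aM.
exact: le_trans (norm_coord_le _ _) bM.
Qed.

Lemma norm_lsubmx_le p q (z : 'rV[R]_(p + q)) : `|lsubmx z| <= `|z|.
Proof. by apply: norm_row_le => // i; rewrite mxE; exact: norm_coord_le. Qed.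

Lemma norm_rsubmx_le p q (z : 'rV[R]_(p + q)) : `|rsubmx z| <= `|z|.
Proof. by apply: norm_row_le => // i; rewrite mxE; exact: norm_coord_le. Qed.

Lemma norm_const_le (s : R) M : `|s| <= M -> `|const_mx s : 'rV[R]_1| <= M.
Proof.
move=> sM; apply: norm_row_le => [|i]; first exact: le_trans sM.
by rewrite mxE.
Qed.

Lemma norm_pt_le s x M : `|s| <= M -> `|x| <= M -> `|pt s x| <= M.
Proof. by move=> sM xM; apply: norm_row_mx_le => //; exact: norm_const_le. Qed.

Lemma norm_cpt_le x t s M :
  `|x| <= M -> `|t| <= M -> `|s| <= M -> `|cpt x t s| <= M.
Proof.
by move=> xM tM sM; apply: norm_row_mx_le => //; apply: norm_row_mx_le;
  exact: norm_const_le.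
Qed.

Lemma row1_const (v : 'rV[R]_1) : v = const_mx (v 0 0).
Proof. by apply/rowP => i; rewrite mxE ord1. Qed.

Lemma ptE (z : 'rV[R]_(1 + n)) : z = pt (lsubmx z 0 0) (rsubmx z).
Proof. by rewrite /pt -row1_const hsubmxK. Qed.

Lemma cpt_line x t s : cpt x t s = cpt x t 0 + s *: delta_mx 0 (i_s n).
Proof.
apply/rowP => i; rewrite mxE [in RHS]mxE !row_mx_coord.
have -> : (s *: (delta_mx 0 (i_s n) : 'rV[R]__)) 0 i = s * (i == i_s n)%:R.
  by rewrite !mxE eqxx.
case: splitP => k ik.
  rewrite (_ : (i == _) = false) ?mulr0 ?addr0//; apply/negbTE.
  by rewrite -val_eqE/= ik neq_ltn (ltn_addr _ (ltn_ord k)).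
rewrite !row_mx_coord; case: splitP => l kl; rewrite !mxE.
  rewrite (_ : (i == _) = false) ?mulr0 ?addr0//; apply/negbTE.
  by rewrite -val_eqE/= ik kl ord1/= eqn_add2l.
by rewrite (_ : i == _) ?mulr1 ?add0r// -val_eqE/= ik kl ord1.
Qed.

Lemma is_derive_char (f : 'rV[R]_(n + (1 + 1)) -> R) x t (s : R) :
  (forall z, differentiable f z) ->
  is_derive s (1 : R) (fun r => f (cpt x t r)) (dd (i_s n) f (cpt x t s)).
Proof.
move=> df.
have -> : (fun r => f (cpt x t r)) =
    fun r => f (cpt x t 0 + r *: delta_mx 0 (i_s n)).
  by apply/funext => r; rewrite cpt_line.
rewrite [cpt x t s]cpt_line; apply: (is_derive_eq (is_derive_line _ _ s df)).
rewrite (bigD1 (i_s n))//= big1 ?addr0 => [|i /negPf ii].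
  by rewrite mxE !eqxx mul1r.
by rewrite mxE eqxx ii mul0r.
Qed.

Section Flow.
Variables (A : 'I_n -> rnet R (1 + n)) (C : 'I_n -> rnet R (n + (1 + 1))).
Hypothesis AC : char_net A C.

Definition flow e x t s : 'rV[R]_(1 + n) := pt s (cv C e (cpt x t s)).

(** The chain rule for F(s, gamma). Replacing the s-derivative of gamma by -A turns it into
    [transport_op] at the same point. *)
Definition flow_deriv (F : rnet R (1 + n)) e x t s : R :=
  dd (i_t n) (F e) (flow e x t s) +
  \sum_j dd (i_s n) (C j e) (cpt x t s) * dd (i_x j) (F e) (flow e x t s).

Definition transport_op (F : rnet R (1 + n)) : rnet R (1 + n) := fun e z =>
  dd (i_t n) (F e) z - \sum_j A j e z * dd (i_x j) (F e) z.

Lemma is_derive_flow (F : rnet R (1 + n)) e x t s : rsmooth_net F -> 0 < e <= 1 ->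
  is_derive s (1 : R) (fun r => F e (flow e x t r)) (flow_deriv F e x t s).
Proof.
move=> sF e01.
pose dp (i : 'I_(1 + n)) := match fintype.split i with
  | inl _ => 1 | inr j => dd (i_s n) (C j e) (cpt x t s) end.
have H := @is_derive_curve R _ (F e) (flow e x t) dp s.
apply: (is_derive_eq (H _ _)) => [|i|].
- exact/rsmooth_differentiable/sF.
- rewrite /dp /flow /pt; under eq_fun do rewrite row_mx_coord.
  case: fintype.split => j; under eq_fun do rewrite mxE.
    exact: is_derive_id.
  by apply: is_derive_char => z; exact/rsmooth_differentiable/(char_smooth AC).
rewrite big_split_ord/= big_ord1 /dp (unsplitK (inl _)) mul1r; congr (_ + _).
by apply: eq_bigr => j _; rewrite (unsplitK (inr _)).
Qed.


Lemma unif_neg (d : nat) (f : 'I_n -> rnet R d) M : (forall h, bnd (@neg_s R) (f h)) ->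
  exists2 r, neg_s r & \forall e \near 0^'+, forall h z, `|z| <= M -> `|f h e z| <= r e.
Proof.
move=> nf; have H : bnd (@neg_s R) (fun e z => \sum_h `|f h e z|).
  apply: bnd_sum => [||h]; [exact: neg_s0|exact: negD|].
  by apply: (bnd_le (nf h)); apply: nearW => e z; rewrite normr_id.
have [r rn fr] := H M; exists r => //; apply: filterS fr => e fr h z zM.
apply: le_trans (fr z zM); rewrite [leRHS]ger0_norm ?sumr_ge0//.
by rewrite (bigD1 h)//= lerDl sumr_ge0.
Qed.

(** The smallness of the coefficients is known only on balls, and the flow is not yet known to stay
    in one. There is no circle: [barrier] asks for a bound only at those s where |gamma|^2 lies
    between P and P + 1. *)
Lemma flow_bounded T : exists M, 0 <= M /\ \forall e \near 0^'+, forall x t s,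
  `|x| <= T -> `|t| <= T -> `|s| <= T -> `|cv C e (cpt x t s)| <= M.
Proof.
have [T0|T0] := ltP T 0.
  exists 0; split=> //; apply: nearW => e x t s xT.
  by have := le_lt_trans xT T0; rewrite normr_lt0.
have [P0 HP] := char_supp AC.
(* The first summand puts the annulus outside the support of the coefficients; the second dominates
   |gamma(x, t, t)|^2, whose coordinates are at most T plus an initial error of at most 1. *)
pose P := `|P0| + n%:R * (T + 1) ^+ 2.
have P0' : 0 <= P by rewrite addr_ge0// mulr_ge0// sqr_ge0.
exists (P + 1); split; first by rewrite addr_ge0.
have [r1 r1n H1] := unif_neg T (char_ode AC).
have [r2 r2n H2] := unif_neg T (char_init AC).
have H3 : \forall e \near 0^'+, forall h (z : 'rV[R]_(1 + n)), `|z| <= T + (P + 1) ->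
    P0 <= \sum_i (rsubmx z 0 i) ^+ 2 -> `|A h e z| <= e ^+ 1.
  by apply: filter_forall => h; exact: HP.
(* In the annulus a coordinate of gamma is at most P + 1 and its derivative at most 2 e: one e from
   the error in the equation, one from the coefficient. So |gamma|^2 changes at a rate of at most n
   (2 (P + 1) 2) e, and K e <= 1 gives the condition of [barrier], strictly because of the summand
   1. *)
pose K := 8 * T * (n%:R * (2 * (P + 1) * 2)) + 1.
have P1 : 0 <= P + 1 by rewrite addr_ge0.
have K0 : 0 <= n%:R * (2 * (P + 1) * 2) by rewrite !mulr_ge0.
apply: filterS3 (filterI (near0_le1 R) (near0_mul_le K)) (filterI H1 H2)
  (filterI H3 (filterI (r1n 1) (r2n 0))).
move=> e [e01 Ke] [{}H1 {}H2] [{}H3 [{}r1n {}r2n]] x t s xT tT sT.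
rewrite expr1 in r1n; rewrite expr0 in r2n.
have /andP[e0 e1] := e01.
pose f s := \sum_h C h e (cpt x t s) ^+ 2.
pose df s := \sum_h 2 * C h e (cpt x t s) * dd (i_s n) (C h e) (cpt x t s).
have fd r : is_derive r (1 : R) f (df r).
  have -> : f = \sum_h (fun s => C h e (cpt x t s) ^+ 2).
    by apply/funext => y; rewrite /f fct_sumE.
  apply: is_derive_sum => h.
  have := @is_derive_char (C h e) x t r
    (fun z => rsmooth_differentiable _ (char_smooth AC h e01)).
  move=> Ch; have := is_deriveX 2 Ch => /is_derive_eq; apply.
  by rewrite /GRing.scale/= expr1.
(* Since P + 1 >= 1, a square bounded by P + 1 has its root bounded by P + 1 too. *)
have coordle r h : f r <= P + 1 -> `|C h e (cpt x t r)| <= P + 1.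
  move=> fP; have : C h e (cpt x t r) ^+ 2 <= P + 1.
    apply: le_trans fP; rewrite /f (bigD1 h)//= lerDl sumr_ge0// => i _.
    exact: sqr_ge0.
  rewrite -real_normK ?num_real//; set y := `|_|; have : 0 <= y by rewrite normr_ge0.
  by move=> y0; nra.
have normle r : f r <= P + 1 -> `|cv C e (cpt x t r)| <= P + 1.
  move=> fP; apply: norm_row_le => [|h]; first by rewrite addr_ge0.
  by rewrite mxE coordle.
apply/normle/ltW; apply: (@barrier R f df T P (n%:R * (2 * (P + 1) * 2) * e) t s) => //.
- move=> r rT /andP[fP fP1]; have fP1' := ltW fP1.
  rewrite (le_trans (ler_norm_sum _ _ _))//.
  rewrite -mulrA; apply: sumr_le_const => h.
  rewrite normrM normrM normr_nat -!mulrA ler_pM2l//; apply: ler_pM => //.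
    exact: coordle.
  have rc : `|cpt x t r| <= T by exact: norm_cpt_le.
  have := H1 h _ rc; rewrite !row_mxKr => ode.
  have Ale : `|A h e (row_mx (const_mx r) (cv C e (cpt x t r)))| <= e ^+ 1.
    apply: H3.
      apply: norm_pt_le; first by rewrite (le_trans rT)// lerDl addr_ge0.
      by rewrite (le_trans (normle _ fP1'))// lerDr.
    rewrite row_mxKr; under eq_bigr do rewrite mxE.
    rewrite (le_trans (ler_norm P0))// (le_trans _ (ltW fP))// /P lerDl.
    by rewrite mulr_ge0// sqr_ge0.
  rewrite expr1 in Ale.
  have -> : dd (i_s n) (C h e) (cpt x t r) =
    (dd (i_s n) (C h e) (cpt x t r) + A h e (row_mx (const_mx r) (cv C e (cpt x t r))))
    - A h e (row_mx (const_mx r) (cv C e (cpt x t r))) by rewrite addrK.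
  rewrite (le_trans (ler_normB _ _))// mulr2n mulrDl mul1r lerD//.
  by rewrite (le_trans ode)// (le_trans (ler_norm _)).
- by rewrite mulr_ge0// ltW.
- rewrite (lt_le_trans _ Ke)// /K mulrDl mul1r -!mulrA; lra.
- rewrite /f /P -[leLHS]add0r lerD//; apply: sumr_le_const => h.
  have := H2 h (pt t x) (norm_pt_le tT xT); rewrite !row_mxKr !row_mxKl => init.
  have : `|C h e (cpt x t t)| <= T + 1.
    have -> : C h e (cpt x t t) = x 0 h + (C h e (cpt x t t) - x 0 h) by ring.
    rewrite (le_trans (ler_normD _ _))// lerD//.
      exact: le_trans (norm_coord_le _ _) xT.
    by rewrite (le_trans init)// (le_trans (ler_norm _)).
  by move=> CT; rewrite -real_normK ?num_real// lerXn2r ?nnegrE// addr_ge0.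
Qed.

Lemma flow_in_ball T : exists M, [/\ 0 <= M, T <= M & \forall e \near 0^'+,
  forall x t s, `|x| <= T -> `|t| <= T -> `|s| <= T -> `|flow e x t s| <= M].
Proof.
have [M [M0 HM]] := flow_bounded T.
exists (`|T| + M); split; rewrite ?addr_ge0//.
  by rewrite (le_trans (ler_norm _))// lerDl.
apply: filterS HM => e HM x t s xT tT sT; apply: norm_pt_le.
  by rewrite (le_trans sT)// (le_trans (ler_norm _))// lerDl.
by rewrite (le_trans (HM _ _ _ xT tT sT))// lerDr.
Qed.

(** The difference is the sum over j of the error in the j-th characteristic equation times an
    x-derivative of F: negligible times moderate. *)
Lemma flow_deriv_transport F T :
  (forall j, bnd (@mod_s R) (fun e => dd (i_x j) (F e))) ->
  exists2 r, neg_s r & \forall e \near 0^'+, forall x t s,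
    `|x| <= T -> `|t| <= T -> `|s| <= T ->
    `|flow_deriv F e x t s - transport_op F e (flow e x t s)| <= r e.
Proof.
move=> mF; have [M [M0 TM HM]] := flow_in_ball T.
have [r1 r1n H1] := unif_neg M (char_ode AC).
have mF' : bnd (@mod_s R) (fun e z => \sum_j `|dd (i_x j) (F e) z|).
  apply: bnd_sum => [||j]; [exact: mod_s0|exact: modD|].
  by apply: (bnd_le (mF j)); apply: nearW => e z; rewrite normr_id.
have [m mm H2] := mF' M.
exists (fun e => `|r1 e * m e|).
  by apply: (neg_solid (neg_mul_mod r1n mm)); apply: nearW => e; rewrite normr_id.
apply: filterS3 HM H1 H2 => e {}HM {}H1 {}H2 x t s xT tT sT.
have cM : `|cpt x t s| <= M by apply: norm_cpt_le; exact: le_trans TM.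
have {}H2 := le_trans (ler_norm _) (H2 _ (HM _ _ _ xT tT sT)).
have -> : flow_deriv F e x t s - transport_op F e (flow e x t s) =
    \sum_j (dd (i_s n) (C j e) (cpt x t s) + A j e (flow e x t s)) *
            dd (i_x j) (F e) (flow e x t s).
  rewrite /flow_deriv /transport_op; under [RHS]eq_bigr do rewrite mulrDl.
  by rewrite big_split/=; ring.
rewrite (le_trans (ler_norm_sum _ _ _))// normrM.
apply: (@le_trans _ _ (\sum_j `|r1 e| * `|dd (i_x j) (F e) (flow e x t s)|)).
  apply: ler_sum => j _; rewrite normrM ler_wpM2r// (le_trans _ (ler_norm _))//.
  by have := H1 j _ cM; rewrite !row_mxKr.
by rewrite -mulr_sumr ler_wpM2l// (le_trans H2)// ler_norm.
Qed.

(** The flow starts at (t, x) only up to a negligible error; by the mean value theorem moderate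
    first derivatives of F carry this over to the values of F. *)
Lemma flow_endpoint F T : rsmooth_net F ->
  (forall i, bnd (@mod_s R) (fun e => dd i (F e))) ->
  exists2 r, neg_s r & \forall e \near 0^'+, forall x t,
    `|x| <= T -> `|t| <= T -> `|F e (flow e x t t) - F e (pt t x)| <= r e.
Proof.
move=> sF mF; have [M [M0 TM HM]] := flow_in_ball T.
have [r1 r1n H1] := unif_neg T (char_init AC).
have mF' : bnd (@mod_s R) (fun e z => \sum_i `|dd i (F e) z|).
  apply: bnd_sum => [||j]; [exact: mod_s0|exact: modD|].
  by apply: (bnd_le (mF j)); apply: nearW => e z; rewrite normr_id.
have [m mm H2] := mF' (M + (M + T)).
exists (fun e => `|r1 e * m e|).
  by apply: (neg_solid (neg_mul_mod r1n mm)); apply: nearW => e; rewrite normr_id.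
apply: filterS3 (filterI (near0_le1 R) HM) H1 H2 => e [e01 {}HM] {}H1 {}H2 x t xT tT.
have FM := HM _ _ _ xT tT tT.
have pM : `|pt t x| <= T by exact: norm_pt_le.
have [th [th0 th1 ->]] := mvt_segment (pt t x) (flow e x t t)
  (fun z => rsmooth_differentiable z (sF e e01)).
set y := pt t x + _.
have yM : `|y| <= M + (M + T).
  rewrite (le_trans (ler_normD _ _))// lerD ?(le_trans pM)// normrZ ger0_norm//.
  rewrite -[leRHS]mul1r ler_pM// (le_trans (ler_normB _ _))// lerD//.
have {}H2 := le_trans (ler_norm _) (H2 _ yM).
rewrite (le_trans (ler_norm_sum _ _ _))// normrM.
apply: (@le_trans _ _ (\sum_i `|r1 e| * `|dd i (F e) y|)).
  apply: ler_sum => i _; rewrite normrM ler_wpM2r//.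
  rewrite /flow /pt opp_row_mx add_row_mx row_mx_coord.
  case: fintype.split => k; rewrite !mxE; first by rewrite subrr normr0.
  rewrite (le_trans _ (ler_norm _))//.
  by have := H1 k _ pM; rewrite !row_mxKr !row_mxKl.
by rewrite -mulr_sumr ler_wpM2l// (le_trans H2)// ler_norm.
Qed.

(* [F] is almost constant along the flow, which runs from (t, x) at s = t to
   (0, gamma(x, t, 0)) at s = 0. *)
Lemma transport_eq_flow F h : rsmooth_net F ->
  (forall i, bnd (@mod_s R) (fun e => dd i (F e))) ->
  bnd (@neg_s R) (transport_op F) ->
  bnd (@neg_s R) (fun e x => F e (pt 0 x) - x 0 h) ->
  bnd (@neg_s R) (fun e z => F e z - C h e (cpt (rsubmx z) (lsubmx z 0 0) 0)).
Proof.
move=> sF mF LF F0 T.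
have [M [M0 TM HM]] := flow_in_ball T.
have [r1 r1n H1] := flow_deriv_transport T (fun j => mF (i_x j)).
have [r2 r2n H2] := flow_endpoint T sF mF.
have [r3 r3n H3] := LF M.
have [r4 r4n H4] := F0 M.
exists (fun e => r2 e + ((r1 e + r3 e) * T + r4 e)).
  apply: negD => //; apply: negD => //; apply: neg_mul_mod.
    exact: negD.
  exact/slow_sub_mod/slow_cst.
apply: filterS3 (filterI (near0_le1 R) HM) (filterI H1 H2) (filterI H3 H4).
move=> e [e01 {}HM] [{}H1 {}H2] [{}H3 {}H4] z zT.
set x := rsubmx z; set t := lsubmx z 0 0.
have xT : `|x| <= T by rewrite (le_trans (norm_rsubmx_le _)).
have tT : `|t| <= T.
  by rewrite (le_trans (norm_coord_le _ _))// (le_trans (norm_lsubmx_le _)).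
have T0 : `|0 : R| <= T by rewrite normr0 (le_trans _ zT).
have h2 := H2 x t xT tT.
have h1 : `|F e (flow e x t t) - F e (flow e x t 0)| <= (r1 e + r3 e) * T.
  have B0 : forall s, `|s| <= T -> `|flow_deriv F e x t s| <= r1 e + r3 e.
    move=> s sT; have a1 := H1 x t s xT tT sT.
    have a2 := H3 _ (HM x t s xT tT sT).
    rewrite -[flow_deriv _ _ _ _ _](subrK (transport_op F e (flow e x t s))).
    by rewrite (le_trans (ler_normD _ _))// lerD.
  have := mean_value_le (fun s => is_derive_flow x t s sF e01) B0 T0 tT.
  rewrite subr0 => /le_trans; apply; apply: ler_wpM2l => //.
  exact: le_trans (B0 _ T0).
have h4 : `|F e (flow e x t 0) - C h e (cpt x t 0)| <= r4 e.
  have cM : `|cv C e (cpt x t 0)| <= M.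
    rewrite (le_trans _ (HM x t 0 xT tT T0))//.
    rewrite -[X in `|X|](row_mxKr (const_mx 0 : 'rV_1)).
    exact: norm_rsubmx_le.
  by have := H4 _ cM; rewrite mxE.
rewrite {1}[z]ptE -/x -/t.
have -> : F e (pt t x) - C h e (cpt x t 0) =
  - (F e (flow e x t t) - F e (pt t x)) +
  ((F e (flow e x t t) - F e (flow e x t 0)) +
   (F e (flow e x t 0) - C h e (cpt x t 0))) by ring.
rewrite (le_trans (ler_normD _ _))// lerD ?normrN//.
by rewrite (le_trans (ler_normD _ _))// lerD.
Qed.

End Flow.
End Characteristics.

(** * Slow scale estimates *)


Section SlowScale.
Variable R : realType.

Definition comm_mul d (s : seq 'I_d) (f g : rnet R d) : rnet R d := fun e z =>
  dds s (fun y => f e y * g e y) z - f e z * dds s (g e) z.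

(** Giving the innermost derivative k to f or to g isolates the top-order term [dd k f * dds s g].
    The other two summands are commutators with the shorter sequence s, which allows induction. *)
Lemma comm_mul_rcons d (s : seq 'I_d) k (f g : rnet R d) e z :
  rsmooth (f e) -> rsmooth (g e) ->
  comm_mul (rcons s k) f g e z =
    comm_mul s (fun e => dd k (f e)) g e z + dd k (f e) z * dds s (g e) z
    + comm_mul s f (fun e => dd k (g e)) e z.
Proof.
move=> sf sg; rewrite /comm_mul !dds_rcons.
have -> : dd k (fun y => f e y * g e y) =
    fun y => dd k (f e) y * g e y + f e y * dd k (g e) y.
  by apply/funext => y; rewrite ddM//; exact: rsmooth_differentiable.
rewrite ddsD; [ring|apply: rsmoothM => //; exact: rsmooth_dd..].
Qed.

Lemma rsmooth_net_dd d (i : 'I_d) (f : rnet R d) :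
  rsmooth_net f -> rsmooth_net (fun e => dd i (f e)).
Proof. by move=> sf e e01; exact/rsmooth_dd/sf. Qed.

Lemma allb_dd d X (i : 'I_d) (f : rnet R d) :
  allb X f -> allb X (fun e => dd i (f e)).
Proof. exact: (@allb_dds _ _ _ [:: i]). Qed.

Lemma subseq_rcons2 (T : eqType) (r s : seq T) k :
  subseq r s -> subseq (rcons r k) (rcons s k).
Proof. by move=> rs; rewrite -!cats1 cat_subseq. Qed.

Lemma subseq_rconsr (T : eqType) (r s : seq T) k :
  subseq r s -> subseq r (rcons s k).
Proof. by move=> rs; apply: (subseq_trans rs); exact: subseq_rcons. Qed.

(* The commutator only involves derivatives of [g] of order < |s|. *)
Lemma bnd_comm_mul d (s : seq 'I_d) (f g : rnet R d) :
  allb (@slow_s R) f -> rsmooth_net g ->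
  (forall r, subseq r s -> (size r < size s)%N ->
    bnd (@slow_s R) (fun e => dds r (g e))) ->
  bnd (@slow_s R) (comm_mul s f g).
Proof.
elim/last_ind: s f g => [|s k IH] f g sf sg gs.
  apply: (@bnd_eq _ _ _ (fun _ _ => 0)) => [e _ z|M].
    by rewrite /comm_mul /= subrr.
  exists (fun=> 0); first exact: slow_cst.
  by apply: nearW => e z _; rewrite normr0.
apply: bnd_eq => [e e01 z|].
  by rewrite [RHS]comm_mul_rcons//; [exact: sf.1|exact: sg].
have ss r : subseq r s -> (size r <= size s)%N ->
    bnd (@slow_s R) (fun e => dds r (g e)).
  by move=> rs rss; apply: gs; [exact: subseq_rconsr|rewrite size_rcons].
apply: bndD; [exact: slowD| |].
  apply: bndD; [exact: slowD| |].
    apply: IH => // [|r rs /ltnW]; [exact: allb_dd|exact: ss].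
  apply: (bndM (@slowM R)); first exact: (sf.2 [:: k]).
  exact: ss.
apply: IH => // [|r rs rss]; first exact: rsmooth_net_dd.
have := gs (rcons r k) (subseq_rcons2 _ rs).
by rewrite !size_rcons ltnS => /(_ rss); under eq_fun do rewrite dds_rcons.
Qed.

(** A logarithmic multiple of S plus a slow scale remainder is the form of right-hand side that
    Gronwall's inequality converts into a slow scale bound on S. *)
Definition dom d (S H : rnet R d) := forall M, exists lam sig,
  [/\ log_s lam, slow_s sig & \forall e \near 0^'+, forall z, `|z| <= M ->
    `|H e z| <= lam e * S e z + sig e].

Lemma dom_slow d (S H : rnet R d) : bnd (@slow_s R) H -> dom S H.
Proof.
move=> Hs M; have [x xs Hx] := Hs M; exists (fun=> 0), x; split=> //.
  exact: log_cst.
by apply: filterS Hx => e Hx z /Hx; rewrite mul0r add0r.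
Qed.

Lemma domD d (S H1 H2 : rnet R d) : dom S H1 -> dom S H2 ->
  dom S (fun e z => H1 e z + H2 e z).
Proof.
move=> D1 D2 M; have [[l1 [s1 [l1l s1s H1b]]] [l2 [s2 [l2l s2s H2b]]]] := (D1 M, D2 M).
exists (fun e => l1 e + l2 e), (fun e => s1 e + s2 e); split.
- exact: logD.
- exact: slowD.
- apply: filterS2 H1b H2b => e {}H1b {}H2b z zM.
  rewrite (le_trans (ler_normD _ _))// (le_trans (lerD (H1b z zM) (H2b z zM)))//.
  by rewrite le_eqVlt; apply/orP; left; apply/eqP; ring.
Qed.

Lemma dom_le d (S H G : rnet R d) : dom S H ->
  (forall e z, 0 < e <= 1 -> `|G e z| <= `|H e z|) -> dom S G.
Proof.
move=> D GH M; have [l [s [ll ss Hb]]] := D M; exists l, s; split=> //.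
apply: filterS2 (near0_le1 R) Hb => e e01 {}Hb z zM.
by rewrite (le_trans (GH _ _ e01))// Hb.
Qed.

Lemma dom_sum (I : Type) (r : seq I) d (S : rnet R d) (H : I -> rnet R d) :
  (forall i, dom S (H i)) -> dom S (fun e z => \sum_(i <- r) H i e z).
Proof.
move=> D; elim: r => [|i r IH].
  apply: (@dom_le _ _ (fun _ _ => 0)) => [|e z _]; last by rewrite big_nil.
  apply: dom_slow => M; exists (fun=> 0); first exact: slow_cst.
  by apply: nearW => e z _; rewrite normr0.
by apply: (dom_le (domD (D i) IH)) => e z _; rewrite big_cons.
Qed.

(** In the commutator f is differentiated at least once. If g receives |s| - 1 derivatives, f
    receives exactly one, which supplies the logarithmic factor; otherwise g is of lower order and
    slow scale factors suffice. *)
Lemma dom_comm_mul d (s : seq 'I_d) (f g S : rnet R d) :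
  allb (@slow_s R) f ->
  (forall k, k \in s -> bnd (@log_s R) (fun e => dd k (f e))) ->
  rsmooth_net g ->
  (forall r, subseq r s -> ((size r).+1 < size s)%N ->
    bnd (@slow_s R) (fun e => dds r (g e))) ->
  (forall r, subseq r s -> (size r).+1 = size s ->
    forall e z, `|dds r (g e) z| <= S e z) ->
  dom S (comm_mul s f g).
Proof.
elim/last_ind: s g => [|s k IH] g sf lf sg gs gS.
  apply: (@dom_le _ _ (fun _ _ => 0)) => [|e z _]; last first.
    by rewrite /comm_mul /= subrr.
  apply: dom_slow => M; exists (fun=> 0); first exact: slow_cst.
  by apply: nearW => e z _; rewrite normr0.
apply: dom_le => [|e z e01]; last first.
  by rewrite comm_mul_rcons//; [exact: lexx|exact: sf.1|exact: sg].
apply: domD; first apply: domD.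
- apply/dom_slow/bnd_comm_mul => // [|r rs rss]; first exact: allb_dd.
  by apply: gs; [exact: subseq_rconsr|rewrite size_rcons].
- move=> M; have ks : k \in rcons s k by rewrite mem_rcons mem_head.
  have [l ll fl] := lf k ks M; exists l, (fun=> 0); split=> //; first exact: slow_cst.
  apply: filterS fl => e fl z zM; rewrite addr0 normrM ler_pM// ?fl//.
  by apply: gS; [exact: subseq_rcons|rewrite size_rcons].
- apply: IH => // [j js||r rs rss|r rs rss e z].
  + by apply: lf; rewrite mem_rcons inE js orbT.
  + exact: rsmooth_net_dd.
  + have := gs (rcons r k) (subseq_rcons2 _ rs).
    by rewrite !size_rcons ltnS => /(_ rss); under eq_fun do rewrite dds_rcons.
  + rewrite -dds_rcons; apply: gS; first exact: subseq_rcons2.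
    by rewrite !size_rcons rss.
Qed.

End SlowScale.

(** * Slow scale bounds for solutions of the transport equation *)

Section SlowTransport.
Variables (R : realType) (n : nat).
Variables (A : 'I_n -> rnet R (1 + n)) (C : 'I_n -> rnet R (n + (1 + 1))).
Hypothesis AC : char_net A C.
Hypothesis A_slow : forall j, allb (@slow_s R) (A j).
Hypothesis A_log : forall j k, bnd (@log_s R) (fun e => dd (i_x k) (A j e)).
Variable V : rnet R (1 + n).
Hypothesis V_mod : allb (@mod_s R) V.
Hypothesis V_transport : allb (@neg_s R) (transport_op A V).
Hypothesis V_init : forall r, bnd (@slow_s R)
  (fun e y => dds (map (@i_x n) r) (V e) (pt 0 y)).

Definition Dx (r : seq 'I_n) : rnet R (1 + n) := fun e => dds (map (@i_x n) r) (V e).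

Lemma Dx_mod r : allb (@mod_s R) (Dx r).
Proof. exact: allb_dds. Qed.

Lemma transport_op_Dx r e z : 0 < e <= 1 ->
  transport_op A (Dx r) e z = dds (map (@i_x n) r) (transport_op A V e) z +
    \sum_j comm_mul (map (@i_x n) r) (A j) (fun e => dd (i_x j) (V e)) e z.
Proof.
move=> e01; have sV := V_mod.1 e e01.
have sAV j : rsmooth (fun y => A j e y * dd (i_x j) (V e) y).
  by apply: rsmoothM; [exact: (A_slow j).1|exact: rsmooth_dd].
have -> : transport_op A V e =
    fun y => dd (i_t n) (V e) y - \sum_j A j e y * dd (i_x j) (V e) y by [].
rewrite ddsB; [|exact: rsmooth_dd|exact: rsmooth_sum].
rewrite dds_sum// /transport_op /Dx dds_comm// /comm_mul sumrB.
under eq_bigr do rewrite dds_comm//.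
by ring.
Qed.

Lemma subseq_map_ix r0 (r : seq 'I_(1 + n)) : subseq r (map (@i_x n) r0) ->
  exists r1, r = map (@i_x n) r1.
Proof. by move=> /subseqP[b _ ->]; exists (mask b r0); rewrite map_mask. Qed.

(** The commutators couple the derivatives of order m, so they are estimated together. Summing over
    ordered tuples repeats multi-indices, which only affects constants. *)
Definition level m : rnet R (1 + n) := fun e z => \sum_(r : m.-tuple 'I_n) `|Dx r e z|.

Lemma Dx_le_level m r e z : size r = m -> `|Dx r e z| <= level m e z.
Proof.
move=> rm; pose r' : m.-tuple 'I_n := Tuple (introT eqP rm).
by rewrite /level (bigD1 r')//= lerDl sumr_ge0.
Qed.

Lemma dom_transport_Dx m (r : m.-tuple 'I_n) :
  (forall r0, (size r0 < m)%N -> bnd (@slow_s R) (Dx r0)) ->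
  dom (level m) (transport_op A (Dx r)).
Proof.
move=> IH.
have D1 : dom (level m) (fun e => dds (map (@i_x n) r) (transport_op A V e)).
  apply: dom_slow; apply: (bnd_sub (@neg_sub_slow R)).
  exact: V_transport.2.
have D2 j : dom (level m)
    (comm_mul (map (@i_x n) r) (A j) (fun e => dd (i_x j) (V e))).
  apply: dom_comm_mul => // [k /mapP[k' _ ->]||r0 /subseq_map_ix[r1 ->]|
                             r0 /subseq_map_ix[r1 ->]].
  - exact: A_log.
  - exact/rsmooth_net_dd/V_mod.1.
  - rewrite !size_map size_tuple => r1m.
    under eq_fun do rewrite -dds_rcons -map_rcons.
    by apply: IH; rewrite size_rcons.
  - rewrite !size_map size_tuple => r1m e z.
    by rewrite -dds_rcons -map_rcons; apply: Dx_le_level; rewrite size_rcons.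
apply: (dom_le (domD D1 (dom_sum (index_enum _) D2))) => e z e01.
by rewrite transport_op_Dx.
Qed.

(** Cauchy-Schwarz against the constant 1, from 2 a_i a_j <= a_i^2 + a_j^2 summed over all pairs. *)
Lemma sqr_sum_le (I : finType) (a : I -> R) :
  (\sum_i a i) ^+ 2 <= #|I|%:R * \sum_i a i ^+ 2.
Proof.
rewrite expr2 mulr_suml.
have -> : #|I|%:R * \sum_i a i ^+ 2 = \sum_i \sum_j (a i ^+ 2 + a j ^+ 2) / 2.
  under [RHS]eq_bigr do rewrite -mulr_suml big_split/= sumr_const.
  rewrite -mulr_suml big_split/= sumr_const sumrMnl -[in LHS]mulr_natl.
  have <- : #|xpredT : pred I| = #|I| by exact: eq_card.
  have half (u : R) : (u + u) / 2 = u by field.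
  by rewrite half mulr1 mulr_natl.
apply: ler_sum => i _; rewrite mulr_sumr; apply: ler_sum => j _.
have := sqr_ge0 (a i - a j); nra.
Qed.

Lemma unif_family (I : finType) X (P : I -> R -> R -> Prop) :
  X (fun=> 0) -> additive_s X -> solid X ->
  (forall i e a b, a <= b -> P i e a -> P i e b) ->
  (forall i, exists2 x, X x & \forall e \near 0^'+, P i e (x e)) ->
  exists2 x, X x & \forall e \near 0^'+, forall i, P i e (x e).
Proof.
move=> X0 Xadd Xs Pmono HP.
have /choice[x Hx] i : exists x, X x /\ \forall e \near 0^'+, P i e (x e).
  by have [x Xx Px] := HP i; exists x.
exists (fun e => \sum_i `|x i e|).
  elim: (index_enum I) => [|i r IH]; first by under eq_fun do rewrite big_nil.
  under eq_fun do rewrite big_cons; apply: Xadd => //.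
  by apply: (Xs _ _ (Hx i).1); apply: nearW => e; rewrite normr_id.
have : \forall e \near 0^'+, forall i, P i e (x i e).
  by apply: filter_forall => i; case: (Hx i).
apply: filterS => e H i; apply: Pmono (H i).
by rewrite (le_trans (ler_norm _))// (bigD1 i)//= lerDl sumr_ge0.
Qed.

(** Here f is a sum of N squares, S the sum of the absolute values, and the left-hand side bounds
    the derivative of f along the flow. Absorbing 2 S b into S^2 + b^2 gives the shape required by
    [gronwall], with b^2 as the additive term. *)
Lemma energy_deriv_le (N S f lam b : R) : 0 <= N -> 0 <= S -> 0 <= f ->
  S ^+ 2 <= N * f ->
  2 * S * (lam * S + b) <= (2 * `|lam| + 1) * (N + 1) * (f + b ^+ 2).
Proof.
move=> N0 S0 f0 SN; have l0 := ler_norm lam; have l1 := normr_ge0 lam.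
set L := `|lam| in l0 l1 *.
have b0 : 0 <= b ^+ 2 by exact: sqr_ge0.
have S20 : 0 <= S ^+ 2 by exact: sqr_ge0.
apply: (@le_trans _ _ ((2 * L + 1) * S ^+ 2 + b ^+ 2)).
  have h1 : lam * S ^+ 2 <= L * S ^+ 2 by rewrite ler_wpM2r.
  have h2 := sqr_ge0 (S - b).
  have -> : 2 * S * (lam * S + b) = 2 * (lam * S ^+ 2) + 2 * S * b by ring.
  have h3 : 2 * S * b <= S ^+ 2 + b ^+ 2.
    by rewrite -subr_ge0; move: h2; congr (_ <= _); ring.
  lra.
have L1 : 0 <= 2 * L + 1 by lra.
have h4 : (2 * L + 1) * S ^+ 2 <= (2 * L + 1) * (N * f) by rewrite ler_wpM2l.
have h5 : 0 <= (2 * L + 1) * f by rewrite mulr_ge0.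
have h6 : 0 <= (2 * L + 1) * N * b ^+ 2 by exact: mulr_ge0 (mulr_ge0 L1 N0) b0.
have h7 : 0 <= 2 * L * b ^+ 2 by exact: mulr_ge0 (mulr_ge0 (ler0n _ 2) l1) b0.
have -> : (2 * L + 1) * (N + 1) * (f + b ^+ 2) = (2 * L + 1) * (N * f) +
  (2 * L + 1) * f + (2 * L + 1) * N * b ^+ 2 + 2 * L * b ^+ 2 + b ^+ 2 by ring.
lra.
Qed.

Lemma le_1_sqr (x y : R) : x ^+ 2 <= y -> `|x| <= 1 + y.
Proof.
by rewrite -real_normK ?num_real//; have := normr_ge0 x; set z := `|x| => z0 zy; nra.
Qed.

(* Gronwall's inequality along the characteristics for the sum of the squares of
   all x-derivatives of order m: the transport operator applied to them is
   logarithmic in the order m and slow scale in the lower orders. *)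
Lemma Dx_slow r0 : bnd (@slow_s R) (Dx r0).
Proof.
have [m rm] : exists m, size r0 = m by exists (size r0).
elim/ltn_ind: m r0 rm => m IH r0 r0m T.
have {}IH r : (size r < m)%N -> bnd (@slow_s R) (Dx r).
  by move=> rm; exact: (IH (size r)).
have s0 : slow_s (fun=> 0 : R) by exact: slow_cst.
have [M [M0 TM HM]] := flow_in_ball AC T.
have DK : dom (level m)
    (fun e z => \sum_(r : m.-tuple 'I_n) `|transport_op A (Dx r) e z|).
  apply: dom_sum => r; apply: (dom_le (dom_transport_Dx r IH)) => e z _.
  by rewrite normr_id.
have {DK} [lam [sig [laml sigs HK]]] := DK M.
have sD r : rsmooth_net (Dx r) := (Dx_mod r).1.
have mD r i : bnd (@mod_s R) (fun e => dd i (Dx r e)) := (Dx_mod r).2 [:: i].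
have [r1 r1s H1] := unif_family s0 (@slowD R) (@slow_solid R)
  (fun (r : m.-tuple 'I_n) e a b ab H x t s xT tT sT => le_trans (H x t s xT tT sT) ab)
  (fun r => let: ex_intro2 y yn Hy :=
       flow_deriv_transport AC T (fun j => mD r (i_x j)) in
     ex_intro2 _ _ y (neg_sub_slow yn) Hy).
have [i0 i0s H0] := unif_family s0 (@slowD R) (@slow_solid R)
  (fun (r : m.-tuple 'I_n) e a b ab H y yM => le_trans (H y yM) ab)
  (fun r => V_init r M).
have [r2 r2n H2] := flow_endpoint AC T (sD r0) (mD r0).
(* The error of the flow in the characteristic equation plus the lower-order part of the
   commutators. *)
pose b e := r1 e + sig e.
pose N : R := #|{: m.-tuple 'I_n}|%:R.
pose N1 := (#|{: m.-tuple 'I_n}|.+1)%N.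
pose L e := (2 * `|lam e| + 1) * (N + 1).
(* [log_exp] takes natural factors, so the time |t| <= T is rounded up in the exponent. *)
pose c := (Num.truncn `|T|).+1.
pose X e := (N * i0 e ^+ 2 + b e ^+ 2) * expR (c%:R * L e).
have Ll : log_s L.
  have -> : L = fun e => N1%:R * (2%:R * `|lam e| + 1).
    by apply/funext => e; rewrite /L /N natr1 mulrC.
  apply/logMn/logD; last exact: log_cst.
  apply: logMn; apply: (log_solid laml).
  by apply: nearW => e; rewrite normr_id.
have bs : slow_s b by exact: slowD.
have Xs : slow_s X.
  apply: slowM; last exact: log_exp.
  apply: slowD; last by have := slowM bs bs; under eq_fun do rewrite -expr2.
  apply: slowM; first exact: slow_cst.
  by have := slowM i0s i0s; under eq_fun do rewrite -expr2.
exists (fun e => 1 + X e + r2 e).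
  apply: slowD; last exact: neg_sub_slow.
  by apply: slowD => //; exact: slow_cst.
apply: filterS3 (filterI (near0_le1 R) HM) (filterI HK H1) (filterI H0 H2).
move=> e [e01 {}HM] [{}HK {}H1] [{}H0 {}H2] z zT.
set x := rsubmx z; set t := lsubmx z 0 0.
have xT : `|x| <= T by rewrite (le_trans (norm_rsubmx_le _)).
have tT : `|t| <= T.
  by rewrite (le_trans (norm_coord_le _ _))// (le_trans (norm_lsubmx_le _)).
have T0 : `|0 : R| <= T by rewrite normr0 (le_trans _ zT).
rewrite [z]ptE -/x -/t.
pose f s := \sum_(r : m.-tuple 'I_n) Dx r e (flow C e x t s) ^+ 2.
pose df s := \sum_(r : m.-tuple 'I_n)
  2 * Dx r e (flow C e x t s) * flow_deriv C (Dx r) e x t s.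
have f0 s : 0 <= f s by apply: sumr_ge0 => r _; exact: sqr_ge0.
have fd s : is_derive s (1 : R) f (df s).
  have -> : f = \sum_(r : m.-tuple 'I_n) (fun s => Dx r e (flow C e x t s) ^+ 2).
    by apply/funext => y; rewrite /f fct_sumE.
  have H (r : m.-tuple 'I_n) : is_derive s (1 : R)
      (fun s => Dx r e (flow C e x t s) ^+ 2)
      (2 * Dx r e (flow C e x t s) * flow_deriv C (Dx r) e x t s).
    have Fd := is_derive_flow AC x t s (sD r) e01.
    have := is_deriveX 2 Fd => /is_derive_eq; apply.
    by rewrite /GRing.scale/= expr1.
  rewrite /df; elim/big_ind2 : _ => //; first exact: is_derive_cst.
  by move=> f1 d1 f2 d2; exact: is_deriveD.
have dfle s : `|s| <= `|t| -> `|df s| <= L e * (f s + b e ^+ 2).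
  move=> st; have sT := le_trans st tT.
  have fM := HM x t s xT tT sT.
  set y := flow C e x t s in fM *.
  have S0 : 0 <= level m e y by apply: sumr_ge0.
  have E := @energy_deriv_le N (level m e y) (f s) (lam e) (b e) _ S0 (f0 s) _.
  apply: le_trans (E _ _) => //.
    rewrite (le_trans (ler_norm_sum _ _ _))//.
    rewrite /level mulr_sumr mulr_suml; apply: ler_sum => r _.
    rewrite !normrM normr_nat -!mulrA ler_pM2l// ler_wpM2l//.
    rewrite -[flow_deriv _ _ _ _ _ _](subrK (transport_op A (Dx r) e y)).
    rewrite (le_trans (ler_normD _ _))// /b addrCA lerD ?H1//.
    rewrite -/(level m e y); apply: le_trans (HK y fM).
    rewrite [leRHS]ger0_norm ?sumr_ge0//.
    by rewrite (bigD1 r)//= lerDl sumr_ge0.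
  rewrite /level (le_trans (sqr_sum_le _))// ler_wpM2l// /f le_eqVlt; apply/orP; left.
  by apply/eqP/eq_bigr => r _; rewrite real_normK// num_real.
have := gronwall fd dfle.
have f0le : f 0 <= N * i0 e ^+ 2.
  rewrite /f mulr_natl -sumr_const; apply: ler_sum => r _.
  have cM : `|cv C e (cpt x t 0)| <= M.
    rewrite (le_trans _ (HM x t 0 xT tT T0))//.
    rewrite -[X in `|X|](row_mxKr (const_mx 0 : 'rV_1)).
    exact: norm_rsubmx_le.
  have := H0 r _ cM; rewrite -/(Dx r e _) => h0.
  by rewrite -real_normK ?num_real// lerXn2r// nnegrE// (le_trans _ h0).
move=> ft; have {}ft : f t <= X e.
  have bb : 0 <= b e ^+ 2 by exact: sqr_ge0.
  apply: (@le_trans _ _ (f t + b e ^+ 2)); first by rewrite lerDl.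
  rewrite (le_trans ft)// /X ler_pM ?expR_ge0 ?addr_ge0 ?lerD//.
  rewrite ler_expR mulrC ler_wpM2r//.
    by rewrite /L mulr_ge0// addr_ge0// mulr_ge0.
  by rewrite (le_trans tT)// (le_trans (ler_norm _))// ltW// truncnS_gt.
have Dt : `|Dx r0 e (flow C e x t t)| <= 1 + X e.
  apply: le_1_sqr; apply: le_trans ft.
  pose r0' : m.-tuple 'I_n := Tuple (introT eqP r0m).
  rewrite /f (bigD1 r0')//= lerDl sumr_ge0// => r _; exact: sqr_ge0.
(* The energy controls the derivative at the endpoint of the flow, which differs from (t, x) by a
   negligible error. *)
have -> : Dx r0 e (pt t x) = Dx r0 e (flow C e x t t) -
  (Dx r0 e (flow C e x t t) - Dx r0 e (pt t x)) by ring.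
by rewrite (le_trans (ler_normB _ _))// lerD// H2.
Qed.

Lemma count_ix (s : seq 'I_(1 + n)) : i_t n \notin s ->
  exists r, s = map (@i_x n) r.
Proof.
elim: s => [|i s IH]; first by exists [::].
rewrite inE negb_or => /andP[it /IH[r ->]].
case: (splitP i) => k ik; last first.
  by exists (k :: r); congr (_ :: _); apply: val_inj.
by case/eqP: it; apply: val_inj; rewrite /= ik ord1.
Qed.

(* Derivatives in t are traded for derivatives in x by the transport equation. *)
Lemma dds_slow s : bnd (@slow_s R) (fun e => dds s (V e)).
Proof.
have [p] := ubnP (count_mem (i_t n) s).
elim: p s => // p IH s; rewrite ltnS => sp.
have [its|/count_ix[r ->]] := boolP (i_t n \in s); last exact: Dx_slow.
(* One derivative in t is moved innermost, where the equation replaces it. The derivatives of V that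
   then occur are subsequences of s' followed by one x-derivative, so they contain fewer t than
   s. *)
have sE : perm_eq s (rcons (rem (i_t n) s) (i_t n)).
  by rewrite perm_sym perm_rcons perm_sym perm_to_rem.
set s' := rem _ _ in sE.
have cs' : count_mem (i_t n) s = (count_mem (i_t n) s').+1.
  by rewrite (permP sE) -cats1 count_cat /= addn1.
rewrite cs' in sp.
have sAV j e : 0 < e <= 1 -> rsmooth (fun y => A j e y * dd (i_x j) (V e) y).
  by move=> e01; apply: rsmoothM; [exact: (A_slow j).1|exact/rsmooth_dd/V_mod.1].
apply: (@bnd_eq _ _ _ (fun e z => dds s' (transport_op A V e) z +
    \sum_j dds s' (fun y => A j e y * dd (i_x j) (V e) y) z)).
  move=> e e01 z; have sV := V_mod.1 e e01.
  rewrite (dds_perm sV sE) dds_rcons.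
  have -> : dd (i_t n) (V e) = fun y => transport_op A V e y +
      \sum_j A j e y * dd (i_x j) (V e) y.
    by apply/funext => y; rewrite /transport_op subrK.
  rewrite ddsD; [|exact: V_transport.1|by apply: rsmooth_sum => j; exact: sAV].
  by rewrite dds_sum// => j; exact: sAV.
apply: bndD; [exact: slowD| |].
  apply: (bnd_sub (@neg_sub_slow R)); exact: V_transport.2.
apply: bnd_sum => [||j]; [exact: slow_cst|exact: slowD|].
apply: (bnd_dds_mul (@slowD R) (@slowM R)) => [||r _|r rs].
- exact: (A_slow j).1.
- exact/rsmooth_net_dd/V_mod.1.
- exact: (A_slow j).2.
- under eq_fun do rewrite -dds_rcons; apply: IH.
  rewrite -cats1 count_cat (_ : count_mem _ [:: _] = 0%N)// addn0.
  by rewrite (leq_ltn_trans _ sp)// leq_count_subseq.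
Qed.

Lemma allb_slow_transport : allb (@slow_s R) V.
Proof. by split; [exact: V_mod.1|exact: dds_slow]. Qed.

End SlowTransport.

(** * Change of representatives *)


Section Representatives.
Variable R : realType.

Lemma repB d (u v : net R d) :
  rep (fun e z => u e z - v e z) = fun e z => rep u e z - rep v e z.
Proof. by apply/funext => e; apply/funext => z; rewrite /rep raddfB. Qed.

Lemma impB d (u v : net R d) :
  imp (fun e z => u e z - v e z) = fun e z => imp u e z - imp v e z.
Proof. by apply/funext => e; apply/funext => z; rewrite /imp raddfB. Qed.

Lemma geqP d (u v : net R d) : u =G v <->
  allb (@neg_s R) (fun e z => rep u e z - rep v e z) /\
  allb (@neg_s R) (fun e z => imp u e z - imp v e z).
Proof. by rewrite -repB -impB; exact: negligible_netP. Qed.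

Lemma allb_sym d (f g : rnet R d) :
  allb (@neg_s R) (fun e z => f e z - g e z) ->
  allb (@neg_s R) (fun e z => g e z - f e z).
Proof.
by move=> /allbN; apply: allb_eq => e _ z; rewrite opprB.
Qed.

Lemma allb_trans d (f g h : rnet R d) :
  allb (@neg_s R) (fun e z => f e z - g e z) ->
  allb (@neg_s R) (fun e z => g e z - h e z) ->
  allb (@neg_s R) (fun e z => f e z - h e z).
Proof.
by move=> fg gh; apply: (allb_eq _ (allbD (@negD R) fg gh)) => e _ z; rewrite subrKA.
Qed.

Lemma geq_sym d (u v : net R d) : u =G v -> v =G u.
Proof. by move=> /geqP[r i]; apply/geqP; split; exact: allb_sym. Qed.

Lemma geq_trans d (u v w : net R d) : u =G v -> v =G w -> u =G w.
Proof.
by move=> /geqP[r i] /geqP[r' i']; apply/geqP; split; [exact: allb_trans r r'|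
  exact: allb_trans i i'].
Qed.

Lemma geq_coord_map d p (sg : 'I_d -> option 'I_p) l (C : R) (u v : net R p) :
  coord_map sg l -> (forall z, `|l z| <= C + `|z|) ->
  u =G v -> (fun e z => u e (l z)) =G (fun e z => v e (l z)).
Proof.
move=> cl lC /geqP[r i]; apply/geqP.
by split; [exact: (allb_coord_map (neg_s0 R) cl lC r)|
  exact: (allb_coord_map (neg_s0 R) cl lC i)].
Qed.

Lemma real_net_imp d (v : net R d) X : X (fun=> 0) -> real_net v -> allb X (imp v).
Proof.
move=> X0 rv; apply: (allb_eq _ (allb_cst0 d X0)) => e e01 z.
by rewrite /imp rv.
Qed.

Lemma allb_dd_sub d (i : 'I_d) (f g : rnet R d) :
  rsmooth_net f -> rsmooth_net g ->
  allb (@neg_s R) (fun e z => f e z - g e z) ->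
  allb (@neg_s R) (fun e z => dd i (f e) z - dd i (g e) z).
Proof.
move=> sf sg fg; apply: (allb_eq _ (allb_dd i fg)) => e e01 z.
have := @ddsB R d [:: i] (f e) (g e) (sf e e01) (sg e e01).
by move=> /(congr1 (fun F => F z)).
Qed.

Lemma rep_dnet d (i : 'I_d) (u : net R d) : rep (dnet i u) = fun e => dd i (rep u e).
Proof. by []. Qed.

Lemma imp_dnet d (i : 'I_d) (u : net R d) : imp (dnet i u) = fun e => dd i (imp u e).
Proof. by []. Qed.

End Representatives.

(** * Passing from generalised functions to suitable representatives *)

Section Assembly.
Variables (R : realType) (n : nat).

Lemma coord_map_pt0 : coord_map (fun k => Some (@i_x n k)) (@pt R n 0).
Proof.
split=> [x|k h y].
  apply: differentiable_row => i; under eq_fun do rewrite row_mx_coord.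
  case: fintype.split => k; last exact: differentiable_coord.
  by under eq_fun do rewrite mxE; exact: differentiable_cst.
by rewrite /pt /i_x delta_mx_rshift scale_row_mx add_row_mx scaler0 add0r.
Qed.

Definition s0_map (z : 'rV[R]_(1 + n)) : 'rV[R]_(n + (1 + 1)) :=
  row_mx (rsubmx z) (row_mx (lsubmx z) 0).

Definition s0_index (i : 'I_(1 + n)) : option 'I_(n + (1 + 1)) :=
  match fintype.split i with
  | inl _ => Some (rshift n (lshift 1 0)) | inr k => Some (lshift (1 + 1) k) end.

Lemma coord_map_s0 : coord_map s0_index s0_map.
Proof.
split=> [x|i h y].
  apply: differentiable_row => k; under eq_fun do rewrite row_mx_coord.
  case: fintype.split => j.
    by under eq_fun do rewrite mxE; exact: differentiable_coord.
  under eq_fun do rewrite row_mx_coord; case: fintype.split => l.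
    by under eq_fun do rewrite mxE; exact: differentiable_coord.
  by under eq_fun do rewrite mxE; exact: differentiable_cst.
rewrite /s0_map /s0_index !linearP/=.
case: (split_ordP i) => k ->.
  rewrite delta_mx_lshift row_mxKl row_mxKr.
  rewrite delta_mx_rshift delta_mx_lshift ord1 !scale_row_mx !add_row_mx.
  by rewrite !scaler0 !add0r.
rewrite delta_mx_rshift row_mxKl row_mxKr.
rewrite delta_mx_lshift !scale_row_mx !add_row_mx.
by rewrite !scaler0 !add0r -[X in row_mx _ X]add0r.
Qed.

Lemma norm_pt0_le (x : 'rV[R]_n) : `|pt 0 x| <= 0 + `|x|.
Proof. by rewrite add0r norm_pt_le// normr0. Qed.

Lemma norm_s0_map_le z : `|s0_map z| <= 0 + `|z|.
Proof.
rewrite add0r; apply: norm_row_mx_le; first exact: norm_rsubmx_le.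
by apply: norm_row_mx_le; [exact: norm_lsubmx_le|rewrite normr0].
Qed.

Lemma dds_pt0 (f : 'rV[R]_(1 + n) -> R) r :
  dds r (fun y => f (pt 0 y)) = fun y => dds (map (@i_x n) r) f (pt 0 y).
Proof.
by elim: r => //= k r ->; rewrite (dd_coord_map _ _ coord_map_pt0).
Qed.

Lemma bnd_dds_coord d (h : 'I_d) r X : (forall c : R, X (fun=> c)) ->
  bnd X (fun _ => dds r (fun y : 'rV[R]_d => y 0 h)).
Proof.
move=> Xc M.
have [E|[c E]] : dds r (fun y : 'rV[R]_d => y 0 h) = (fun y => y 0 h) \/
    exists c, dds r (fun y : 'rV[R]_d => y 0 h) = fun=> c.
  elim: r => [|k r [IH|[c IH]]] /=; first by left.
    by right; exists (h == k)%:R; rewrite IH; apply/funext => y; rewrite dd_coord.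
  by right; exists 0; rewrite IH dd_cst.
- exists (fun=> M) => //; apply: nearW => e z zM; rewrite E.
  exact: le_trans (norm_coord_le _ _) zM.
- by exists (fun=> `|c|) => //; apply: nearW => e z zM; rewrite E.
Qed.

Lemma compact_annulus M P :
  compact [set z : 'rV[R]_(1 + n) | `|z| <= M /\ P <= \sum_i (rsubmx z 0 i) ^+ 2].
Proof.
apply: (subclosed_compact _ (@compact_ball R (1 + n) M)) => [|z []//].
apply: closedI.
  exact: closed_norm_le.
pose f (z : 'rV[R]_(1 + n)) := \sum_i (rsubmx z 0 i) ^+ 2.
apply: (@preimage_closed _ _ f [set x | P <= x]); last exact: closed_ge.
move=> z _; apply: differentiable_continuous; apply: rsmooth_differentiable.
have -> : f = fun z => \sum_i rsubmx z 0 i * rsubmx z 0 i.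
  by apply/funext => y; apply: eq_bigr => i _; rewrite expr2.
by apply: rsmooth_sum => i; apply: rsmoothM; exact: rsmooth_rsubmx.
Qed.

(** Off the support u is negligible only locally, near each point. The joint filter in y and e is
    the form in which the covering property of compact sets makes this uniform. *)
Lemma vanishes_near (u : net R (1 + n)) z (q : nat) : ~ gsupp u z ->
  \forall y \near z & e \near 0^'+, `|rep u e y| <= e ^+ q.
Proof.
move=> zu; have [U [oU Uz vU]] : exists U, [/\ open U, U z & vanishes_on U u].
  by apply: contrapT => H; apply: zu => U oU Uz vU; apply: H; exists U.
have /nbhs_normP[r /= r0 rU] := open_nbhs_nbhs (conj oU Uz).
pose K := (fun y => z + y) @` [set y : 'rV[R]_(1 + n) | `|y| <= r / 2].
have cK : compact K.
  apply: continuous_compact; last exact: compact_ball.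
  apply/continuous_subspaceT => y; apply: differentiable_continuous.
  exact: differentiableD.
have KU : K `<=` U.
  move=> _ [y /= yr <-]; apply: rU; rewrite /ball_/= opprD addNKr normrN.
  by rewrite (le_lt_trans yr)// ltr_pdivrMr// ltr_pMr// ltr1n.
have [C C0 HC] := bigO_supK (vU K cK KU [::] q.+1).
have nz : \forall y \near z, `|z - y| < r / 2.
  by apply/nbhs_normP; exists (r / 2) => //=; rewrite divr_gt0.
exists ([set y | `|z - y| < r / 2], [set e | 0 < e <= 1 /\
    (C * e <= 1 /\ forall y, K y -> `|rep u e y| <= C * e ^+ q.+1)]).
  split; first exact: nz.
  apply: filterS3 (near0_le1 R) (near0_mul_le C) HC => e e01 Ce {}HC.
  by split=> //; split=> // y /HC[].
move=> [y e] [/= yr [/andP[e0 _] [Ce ue]]].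
have Ky : K y.
  by exists (y - z); [rewrite /= distrC ltW|rewrite addrC subrK].
rewrite (le_trans (ue _ Ky))// exprS mulrA -[leRHS]mul1r ler_wpM2r//.
by rewrite exprn_ge0// ltW.
Qed.

Lemma rep_small_outside (u : net R (1 + n)) : compact_supp_x u ->
  exists P, forall M (q : nat), \forall e \near 0^'+,
    forall z : 'rV[R]_(1 + n), `|z| <= M ->
      P <= \sum_i (rsubmx z 0 i) ^+ 2 -> `|rep u e z| <= e ^+ q.
Proof.
move=> [K /compact_sub_ball[M0 KM] uK].
(* On the support every x-coordinate is at most M0, hence |x|^2 <= n M0^2; the summand 1 keeps the
   closed region |x|^2 >= P away from it. *)
exists (n%:R * M0 ^+ 2 + 1) => M q.
have /compact_near_coveringP cov := @compact_annulus M (n%:R * M0 ^+ 2 + 1).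
have H z : `|z| <= M /\ n%:R * M0 ^+ 2 + 1 <= \sum_i (rsubmx z 0 i) ^+ 2 ->
    \forall y \near z & e \near 0^'+, `|rep u e y| <= e ^+ q.
  move=> [zM zP]; apply: vanishes_near => /uK /= /KM /= zM0.
  have : \sum_i (rsubmx z 0 i) ^+ 2 <= n%:R * M0 ^+ 2.
    apply: sumr_le_const => i; rewrite -real_normK ?num_real//.
    rewrite lerXn2r ?nnegrE//; last exact: le_trans (norm_coord_le _ _) zM0.
    by rewrite (le_trans _ zM0).
  by move=> /(le_trans zP); rewrite gerDl ler10.
have := cov R (0^'+) (fun e z => `|rep u e z| <= e ^+ q) _ H.
move=> /(_ (at_right_proper_filter 0)).
by apply: filterS => e He z zM zP; exact: He.
Qed.

(** The flow stays in a ball by the bound available for B, and on that ball B - A is negligible;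
    hence the equation with A holds up to a negligible error along the same curve. *)
Lemma char_netE (B A : 'I_n -> rnet R (1 + n)) C :
  char_net B C -> (forall h, bnd (@neg_s R) (fun e z => B h e z - A h e z)) ->
  char_net A C.
Proof.
move=> BC BA; split.
- exact: char_smooth BC.
- move=> h T; have [M [M0 TM HM]] := flow_in_ball BC T.
  have [r1 r1n H1] := char_ode BC h T.
  have [r2 r2n H2] := BA h M.
  exists (fun e => r1 e + r2 e); first exact: negD.
  apply: filterS3 HM H1 H2 => e {}HM {}H1 {}H2 z zT.
  set y := row_mx _ _; have yE : y = flow C e (lsubmx z)
      (lsubmx (rsubmx z) 0 0) (rsubmx (rsubmx z) 0 0).
    by rewrite /flow /cpt /pt -!row1_const !hsubmxK.
  have yM : `|y| <= M.
    rewrite yE; apply: HM.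
    + exact: le_trans (norm_lsubmx_le _) zT.
    + rewrite (le_trans (norm_coord_le _ _))// (le_trans (norm_lsubmx_le _))//.
      exact: le_trans (norm_rsubmx_le _) zT.
    + rewrite (le_trans (norm_coord_le _ _))// (le_trans (norm_rsubmx_le _))//.
      exact: le_trans (norm_rsubmx_le _) zT.
  have := H1 z zT; rewrite -/y => h1; have := H2 y yM => h2.
  have -> : dd (i_s n) (C h e) z + A h e y =
    (dd (i_s n) (C h e) z + B h e y) - (B h e y - A h e y) by ring.
  by rewrite (le_trans (ler_normB _ _))// lerD.
- exact: char_init BC.
- have [P HP] := char_supp BC; exists P => h M q.
  have [r rn Hr] := BA h M.
  apply: filterS3 (filterI (near0_le1 R) (near0_mul_le 2)) (HP h M q.+1)
    (filterI (rn q.+1) Hr) => e [/andP[e0 e1] e2] {}HP [{}rn {}Hr] z zM zP.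
  have -> : A h e z = B h e z - (B h e z - A h e z) by ring.
  rewrite (le_trans (ler_normB _ _))//.
  have h1 := HP z zM zP.
  have h2 := le_trans (Hr z zM) (le_trans (ler_norm _) rn).
  rewrite (le_trans (lerD h1 h2))// -mulr2n -mulr_natl exprS mulrA.
  by rewrite -[leRHS]mul1r ler_wpM2r// exprn_ge0// ltW.
Qed.

Lemma char_net_rep (a b : 'I_n -> net R (1 + n)) (c : 'I_n -> net R (n + (1 + 1))) :
  (forall h, compact_supp_x (a h)) -> (forall h, is_repr (a h) (b h)) ->
  (forall h, moderate (c h)) ->
  (forall h, dnet (@i_s n) (c h) =G fun e z =>
     - b h e (row_mx (rsubmx (rsubmx z)) (\row_j complex.Re (c j e z)))) ->
  (forall h, (fun e (z : 'rV[R]_(1 + n)) =>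
     c h e (row_mx (rsubmx z) (row_mx (lsubmx z) (lsubmx z))))
       =G fun _ z => (rsubmx z 0 h)%:C) ->
  char_net (fun h => rep (b h)) (fun h => rep (c h)).
Proof.
move=> supp ab mc ode init; split.
- by move=> h; have /moderateP[[sr _] _] := mc h.
- move=> h; have /geqP[[_ /(_ [::]) H] _] := ode h.
  apply: bnd_eq H => e e01 z /=.
  by rewrite /rep /= raddfN opprK.
- move=> h; have /geqP[[_ /(_ [::]) H] _] := init h.
  by apply: bnd_eq H => e e01 z.
- have /choice[P HP] h := rep_small_outside (supp h).
  exists (\sum_h `|P h|) => h M q.
  have /geqP[[_ /(_ [::] M)[r rn Hr]] _] := (ab h).2.
  apply: filterS3 (filterI (near0_le1 R) (near0_mul_le 2)) (HP h M q.+1)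
    (filterI (rn q.+1) Hr) => e [/andP[e0 e1] e2] {}HP [{}rn {}Hr] z zM zP.
  have -> : rep (b h) e z = rep (a h) e z - (rep (a h) e z - rep (b h) e z) by ring.
  rewrite (le_trans (ler_normB _ _))//.
  have h1 : `|rep (a h) e z| <= e ^+ q.+1.
    apply: HP => //; apply: le_trans zP; rewrite (le_trans (ler_norm _))//.
    by rewrite (bigD1 h)//= lerDl sumr_ge0.
  have h2 := le_trans (Hr z zM) (le_trans (ler_norm _) rn).
  rewrite (le_trans (lerD h1 h2))// -mulr2n -mulr_natl exprS mulrA.
  by rewrite -[leRHS]mul1r ler_wpM2r// exprn_ge0// ltW.
Qed.

Lemma rep_mul d (u v : net R d) e z :
  complex.Re (u e z * v e z) = rep u e z * rep v e z - imp u e z * imp v e z.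
Proof. by rewrite /rep /imp; case: (u e z) => a b; case: (v e z). Qed.

(** The real part of the equation for w contains products of imaginary parts. They are negligible
    because w differs negligibly from the real net v; then a is replaced by A and w by v, each
    exchange costing a negligible net times a moderate one. *)
Lemma transport_rep (a : 'I_n -> net R (1 + n)) (A : 'I_n -> rnet R (1 + n))
    (w v : net R (1 + n)) :
  (forall j, moderate (a j)) -> moderate w -> moderate v -> real_net v ->
  w =G v -> (forall j, allb (@mod_s R) (A j)) ->
  (forall j, allb (@neg_s R) (fun e z => rep (a j) e z - A j e z)) ->
  dnet (i_t n) w =G (fun e z => \sum_j a j e z * dnet (i_x j) w e z) ->
  allb (@neg_s R) (transport_op A (rep v)).
Proof.
move=> ma mw mv rv wv mA aA eqw.
have /moderateP[mrw miw] := mw; have /moderateP[mrv miv] := mv.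
have /geqP[rwv iwv] := wv; have /geqP[E _] := eqw.
have D i := allb_dd_sub i mrw.1 mrv.1 rwv.
have iw : allb (@neg_s R) (imp w).
  have := allbD (@negD R) iwv (real_net_imp (neg_s0 R) rv).
  by apply: allb_eq => e e01 z; rewrite subrK.
have ne0 := neg_s0 R; have nD := @negD R.
have nm := @neg_mul_mod R.
have mn x y : mod_s x -> neg_s y -> neg_s (fun e : R => x e * y e).
  by move=> xm yn; under eq_fun do rewrite mulrC; exact: neg_mul_mod.
have T1 j : allb (@neg_s R)
    (fun e z => (rep (a j) e z - A j e z) * dd (i_x j) (rep w e) z).
  by apply: (allbM nD nm) => //; exact: allb_dd.
have T2 j : allb (@neg_s R) (fun e z =>
    A j e z * (dd (i_x j) (rep w e) z - dd (i_x j) (rep v e) z)).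
  exact: (allbM nD mn).
have T3 j : allb (@neg_s R) (fun e z => imp (a j) e z * dd (i_x j) (imp w e) z).
  apply: (allbM nD mn); last exact: allb_dd.
  by have /moderateP[] := ma j.
have S := allb_sum (index_enum 'I_n) ne0 nD
  (fun j => allbB nD (allbD nD (T1 j) (T2 j)) (T3 j)).
have := allbD nD (allbB nD E (D (i_t n))) S.
apply: allb_eq => e e01 z; rewrite /transport_op.
rewrite [rep (fun e z => \sum_j _)  e z]/rep raddf_sum/=.
under [X in _ - X - _ + _]eq_bigr do rewrite rep_mul.
rewrite rep_dnet.
have -> : \sum_j A j e z * dd (i_x j) (rep v e) z =
   \sum_j (rep (a j) e z * rep (dnet (i_x j) w) e z -
            imp (a j) e z * imp (dnet (i_x j) w) e z) -
   \sum_j ((rep (a j) e z - A j e z) * dd (i_x j) (rep w e) z +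
     A j e z * (dd (i_x j) (rep w e) z - dd (i_x j) (rep v e) z) -
     imp (a j) e z * dd (i_x j) (imp w e) z).
  by rewrite -sumrB; apply: eq_bigr => j _; rewrite rep_dnet imp_dnet; ring.
by ring.
Qed.

Lemma init_rep (w v : net R (1 + n)) h : w =G v ->
  (fun e (x : 'rV[R]_n) => w e (row_mx 0 x)) =G (fun _ x => (x 0 h)%:C) ->
  allb (@neg_s R) (fun e x => rep v e (pt 0 x) - x 0 h).
Proof.
move=> wv w0.
have := geq_trans (geq_sym (geq_coord_map coord_map_pt0 norm_pt0_le wv)) w0.
by move=> /geqP[].
Qed.

Lemma transport_geq_char (a w : 'I_n -> net R (1 + n))
    (g : 'I_n -> net R (n + (1 + 1))) :
  (forall j, moderate (a j)) -> (forall j, compact_supp_x (a j)) ->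
  (forall h, moderate (w h) /\ real_valued (w h)) ->
  (forall h, transport_solution a h (w h)) ->
  characteristic_curve a g ->
  forall h, w h =G at_s0 (g h).
Proof.
move=> ma supp mw tw [b [c [ab gc ode init]]] h.
have mc h' : moderate (c h') := (gc h').1.1.
have BC := char_net_rep supp ab mc ode init.
have [mwh [v [mv wv] rv]] := mw h.
have mb j : allb (@mod_s R) (rep (b j)) by have /moderateP[] := (ab j).1.
have aA j : allb (@neg_s R) (fun e z => rep (a j) e z - rep (b j) e z).
  by have /geqP[] := (ab j).2.
have L := transport_rep ma mwh mv rv wv mb aA (tw h).1.
have I0 := init_rep wv (tw h).2.
have /moderateP[mrv miv] := mv.
have main := transport_eq_flow BC mrv.1 (fun i => mrv.2 [:: i]) (L.2 [::]) (I0.2 [::]).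
have gs0 := geq_coord_map coord_map_s0 norm_s0_map_le (gc h).1.2.
apply: (geq_trans wv); apply: geq_trans (geq_sym gs0).
have /moderateP[mrc mic] := mc h.
apply/geqP; split.
  apply: allb_neg.
    apply: allbB; [exact: modD|exact: mrv|].
    exact: (allb_coord_map (mod_s0 R) coord_map_s0 norm_s0_map_le mrc).
  apply: bnd_eq main => e e01 z; congr (_ - _).
  by rewrite /rep /s0_map /cpt -row1_const.
apply: (allb_eq _ (allb_cst0 _ (neg_s0 R))) => e e01 z.
by rewrite /imp rv// (gc h).2// subrr.
Qed.

(** Three kinds of representatives of the coefficients meet: b in the characteristic equation, s
    with slow scale derivatives, and l for the logarithmic bound on a first derivative. The real
    part of s serves throughout: [char_netE] transfers the equation to it, and its first
    x-derivatives differ from l by negligible nets, which [log_s] absorbs. *)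
Lemma slow_scale_transport (a w : 'I_n -> net R (1 + n))
    (g : 'I_n -> net R (n + (1 + 1))) (h : 'I_n) (v : net R (1 + n)) :
  (forall j, moderate (a j)) -> (forall j, slow_regular (a j)) ->
  (forall j, compact_supp_x (a j)) ->
  (forall k j, slow_log_type (dnet (i_x k) (a j))) ->
  moderate (w h) -> transport_solution a h (w h) ->
  characteristic_curve a g ->
  is_repr (w h) v -> real_net v -> allb (@slow_s R) (rep v).
Proof.
move=> ma sa supp la mw tw [b [c [ab gc ode init]]] [mv wv] rv.
have mc h' : moderate (c h') := (gc h').1.1.
have BC := char_net_rep supp ab mc ode init.
have /choice[s Hs] j : exists s, is_repr (a j) s /\ forall K, compact K ->
    forall r : seq 'I_(1 + n), exists2 mu, slow_scale mu &
      bigOeps (fun e => supK K (pd r (s e))) (fun e => cabs (mu e)).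
  by have [s ? ?] := sa j; exists s.
pose A j := rep (s j).
have as' j : a j =G s j := (Hs j).1.2.
have mA j : allb (@mod_s R) (A j) by have /moderateP[] := (Hs j).1.1.
have A_slow j : allb (@slow_s R) (A j).
  split; first exact: (mA j).1.
  by move=> r; apply: bnd_slow_net => K cK; exact: (Hs j).2.
have aA j : allb (@neg_s R) (fun e z => rep (a j) e z - A j e z).
  by have /geqP[] := as' j.
have AC : char_net A (fun h => rep (c h)).
  apply: (char_netE BC) => j.
  have /geqP[H _] := geq_trans (geq_sym (ab j).2) (as' j).
  exact: (H.2 [::]).
have A_log j k : bnd (@log_s R) (fun e => dd (i_x k) (A j e)).
  have [l [ml /geqP[al _]] lb] := la k j.
  have /moderateP[mra _] := ma j.
  have := allb_dd_sub (i_x k) mra.1 (mA j).1 (aA j); rewrite -rep_dnet => aAk.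
  have H := allb_trans (allb_sym aAk) al.
  have := bndD (@logD R) (bnd_sub (@neg_sub_log R) (H.2 [::])) (bnd_slow_log_net lb).
  by apply: bnd_eq => e _ z /=; rewrite subrK.
have L := transport_rep ma mw mv rv wv mA aA tw.1.
have I0 := init_rep wv tw.2.
have /moderateP[mrv _] := mv.
apply: (allb_slow_transport AC A_slow A_log mrv L) => r.
have cs (x : R) : slow_s (fun=> x) by exact: slow_cst.
have := bndD (@slowD R) (bnd_sub (@neg_sub_slow R) (I0.2 r)) (bnd_dds_coord h r cs).
have sp e : 0 < e <= 1 -> rsmooth (fun x => rep v e (pt 0 x)).
  by move=> e01; apply: (rsmooth_coord_map coord_map_pt0); exact: mrv.1.
apply: bnd_eq => e e01 z.
by rewrite ddsB ?subrK ?dds_pt0//; [exact: sp|exact: rsmooth_coord].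
Qed.

Lemma slow_scale_cst1 : slow_scale (fun _ : R => 1 : R[i]).
Proof. exact: (slow_scale_real (slow_cst 1)). Qed.

End Assembly.

Unset Implicit Arguments.

Theorem proposition2p3 (R : realType) (n : nat) (hn : (0 < n)%N)
    (a : 'I_n -> net R (1 + n)) (ha : forall j, moderate (a j)) :
  ((forall j, real_valued (a j)) ->
   (forall j, compact_supp_x (a j)) ->
   (forall k j, log_type (dnet (i_x k) (a j))) ->
   forall (w : 'I_n -> net R (1 + n)) (g : 'I_n -> net R (n + (1 + 1))),
     (forall h, moderate (w h) /\ real_valued (w h)) ->
     (forall h, transport_solution a h (w h)) ->
     (forall h, moderate (g h)) ->
     characteristic_curve a g ->
     [/\ generalised_phase (phase_of w),
         sym_eq (phase_of w) (phase_of (fun h => at_s0 (g h)))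
       & eikonal_solution a (phase_of w)])
  /\
  ((forall j, real_valued (a j)) ->
   (forall j, slow_regular (a j)) ->
   (forall j, compact_supp_x (a j)) ->
   (forall k j, slow_log_type (dnet (i_x k) (a j))) ->
   forall (w : 'I_n -> net R (1 + n)) (g : 'I_n -> net R (n + (1 + 1))),
     (forall h, moderate (w h) /\ real_valued (w h)) ->
     (forall h, transport_solution a h (w h)) ->
     (forall h, moderate (g h)) ->
     characteristic_curve a g ->
     slow_scale_generalised_phase (phase_of w)).
Proof.
split=> [_ supp _ w g mw tw _ gc|_ sa supp la w g mw tw _ gc].
  have /choice[v Hv] h : exists v, is_repr (w h) v /\ real_net v.
    by have [_ [v ? ?]] := mw h; exists v.
  split.
  - exists (phase_of v); first by apply: sym_eq_phase_of => h; exact: (Hv h).1.2.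
    by apply: phase_net_phase_of => h; [exact: (Hv h).1.1|exact: (Hv h).2].
  - by apply: sym_eq_phase_of => h; exact: transport_geq_char gc h.
  - by apply: eikonal_phase_of => // h; exact: (mw h).1.
have /choice[v Hv] h : exists v, is_repr (w h) v /\ real_net v.
  by have [_ [v ? ?]] := mw h; exists v.
exists (phase_of v); first by apply: sym_eq_phase_of => h; exact: (Hv h).1.2.
split.
- by apply: phase_net_phase_of => h; [exact: (Hv h).1.1|exact: (Hv h).2].
- apply: sym_slow_scale_clin => h; split.
    apply: (slow_scale_transport ha sa supp la (mw h).1 (tw h) gc (Hv h).1).
    exact: (Hv h).2.
  apply: real_net_imp (Hv h).2; exact: slow_cst.
- move=> K' K _ _; exists (fun=> 1); first exact: slow_scale_cst1.
  apply: nearW => e; split; first exact: oner_neq0.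
  by rewrite /cabs ComplexField.Normc.normc1 invr1; exact: grad_inf_ge1.
Qed.
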